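(* Consider the multi-community preferential attachment model with types described in the context, with communities $S=\{1,\dots,N\}$. Assume that the polynomial $R$ of the type assignment rule has at least two distinct linearly stable fixed points. For each $i\in S$, choose $z_i$ to be one of these linearly stable fixed points. Let $A_1$ be any attractiveness matrix with all diagonal entries positive, let $A_0$ be the diagonal matrix with the same diagonal entries as $A_1$, and for $\theta>0$ let $A_\theta=(1-\theta)A_0+\theta A_1$. Then for any $\varepsilon>0$ there exists $\theta_\varepsilon>0$ such that for every $0<\theta<\theta_\varepsilon$, in the system with attractiveness matrix $A_\theta$, there is positive probability that there exist limits $\tilde z_1,\ldots,\tilde z_N$ with $|z_i-\tilde z_i|<\varepsilon$ for each $i$, such that $Z^{(t)}_i\to\tilde z_i$ as $t\to\infty$ for each $i\in S$. In particular, if $N\ge 2$, there is some $\theta_{\mathrm{crit}}>0$ such that for every $0<\theta<\theta_{\mathrm{crit}}$ there is positive probability of convergence to different limits, that is, that the $Z^{(t)}_i$ all converge as $t\to\infty$ but their limits are not all equal.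
   Context: Model. $S=\{1,\dots,N\}$ is a finite set of communities, $m\ge 1$ is an integer, $\mu=(\mu_i)_{i\in S}$ is a probability distribution on $S$ with $\mu_i>0$ for all $i$, and $A=(\alpha_{x,y})_{x,y\in S}$ (the attractiveness, or interaction, matrix) has non-negative entries with $\sum_x\alpha_{x,y}>0$ for every $y$. The type assignment rule is given by $p_0,\dots,p_m\in[0,1]$. $G_0$ is a fixed finite initial (multi)graph with $n_0$ vertices and $mn_0$ edges, all vertices having positive degree; each vertex $v$ has a community $c(v)\in S$ and a type (colour), red or blue, and each community contains at least one vertex of $G_0$. Given $G_t$, the graph $G_{t+1}$ is obtained by adding a vertex $v_{t+1}$ whose community $c(v_{t+1})$ has law $\mu$, independently of everything else, and $m$ edges from $v_{t+1}$ to $m$ existing vertices chosen independently with replacement, each choice being equal to vertex $v$ with probability $$\frac{\alpha_{c(v),c(v_{t+1})}\deg_{G_t}(v)}{\sum_{u\in V(G_t)}\alpha_{c(u),c(v_{t+1})}\deg_{G_t}(u)}.$$ Then, conditional on exactly $k$ of the $m$ chosen neighbours (with multiplicity) being red, $v_{t+1}$ becomes red with probability $p_k$ and otherwise blue; types never change afterwards. $Z^{(t)}_i=\dfrac{\sum_{v\text{ red},\,c(v)=i}\deg_{G_t}(v)}{\sum_{v:\,c(v)=i}\deg_{G_t}(v)}$ is the proportion of edge-ends in community $i$ at time $t$ which are at red vertices. The polynomial of the rule is $R(z)=\sum_{k=0}^m\binom mk z^k(1-z)^{m-k}p_k$. A fixed point $z\in(0,1)$ of $R$ is stable if for some $\eta>0$,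 $R(y)>y$ for $y\in(z-\eta,z)$ and $R(y)<y$ for $y\in(z,z+\eta)$. A fixed point at $0$ is stable if $R(y)<y$ for $y\in(0,\eta)$ for some $\eta>0$; a fixed point at $1$ is stable if $R(y)>y$ for $y\in(1-\eta,1)$ for some $\eta>0$. A stable fixed point $z$ is linearly stable if $R'(z)<1$.
   Formalization: Added assumption: for each community i, if p_0=0 then G_0 has a red vertex in a community from which i is reachable along positive entries of A_1, and likewise a blue vertex if p_m=1; otherwise Z_i stays at 0 (or 1), e.g. majority rule with G_0 all blue. *)

(* Defs.v *)
From mathcomp Require Import all_boot all_order all_algebra.
From mathcomp Require Import all_classical all_reals all_analysis.

Set Implicit Arguments.
Unset Strict Implicit.
Unset Printing Implicit Defensive.

Import Order.TTheory GRing.Theory Num.Theory.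
Import numFieldNormedType.Exports.

Local Open Scope classical_set_scope.
Local Open Scope ring_scope.

(* The vertex set is {0, ..., nvertices G - 1}; the values of [comm] and      *)
(* [red] at other numbers are irrelevant. An edge is listed as a pair of      *)
(* endpoints whose order plays no role; loops and repetitions are allowed.    *)
Record cgraph (N : nat) := CGraph {
  nvertices : nat;
  comm : nat -> 'I_N;
  red : nat -> bool;
  edges : seq (nat * nat) }.

(* A loop counts twice. *)
Definition deg (N : nat) (G : cgraph N) (v : nat) : nat :=
  (count (fun e : nat * nat => e.1 == v) (edges G)
   + count (fun e : nat * nat => e.2 == v) (edges G))%N.

Definition add_vertex (N m : nat) (G : cgraph N)
    (x : 'I_N) (w : m.-tuple nat) (b : bool) : cgraph N :=
  CGraph (nvertices G).+1
    (fun v => if v == nvertices G then x else comm G v)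
    (fun v => if v == nvertices G then b else red G v)
    (edges G ++ [seq (nvertices G, u) | u <- w]).

(* The graph at time t when the vertex added between times s and s + 1 has    *)
(* community c s, chosen neighbours w s and type b s.                         *)
Fixpoint pa_graph (N m : nat) (G0 : cgraph N) (c : nat -> 'I_N)
    (w : nat -> m.-tuple nat) (b : nat -> bool) (t : nat) : cgraph N :=
  if t is s.+1 then add_vertex (pa_graph G0 c w b s) (c s) (w s) (b s) else G0.

Record initial_graph (N m : nat) (G0 : cgraph N) : Prop := {
  initial_endpoints : forall e, e \in edges G0 ->
    (e.1 < nvertices G0)%N /\ (e.2 < nvertices G0)%N;
  initial_size : size (edges G0) = (m * nvertices G0)%N;
  initial_deg : forall v, (v < nvertices G0)%N -> (0 < deg G0 v)%N;
  initial_comm : forall i, exists2 v, (v < nvertices G0)%N & comm G0 v = i }.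

Section Model.
Variable R : realType.

Record community_law (N : nat) (mu : 'I_N -> R) : Prop := {
  community_law_gt0 : forall i, 0 < mu i;
  community_law_sum : \sum_i mu i = 1 }.

Record attractiveness (N : nat) (A : 'M[R]_N) : Prop := {
  attractiveness_ge0 : forall x y, 0 <= A x y;
  attractiveness_col : forall y, 0 < \sum_x A x y }.

Definition type_rule (m : nat) (p : 'I_m.+1 -> R) : Prop :=
  forall k, 0 <= p k <= 1.

(* Probability that a given edge of a new vertex of community y is attached   *)
(* to v; it vanishes when v is not a vertex, since then deg G v = 0.          *)
Definition attach_prob (N : nat) (A : 'M[R]_N) (G : cgraph N)
    (y : 'I_N) (v : nat) : R :=
  A (comm G v) y * (deg G v)%:R /
  \sum_(u < nvertices G) A (comm G u) y * (deg G u)%:R.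

Section Realization.
Variables (N m : nat) (d : measure_display) (T : measurableType d).
Variables (C : nat -> T -> 'I_N) (W : nat -> T -> m.-tuple nat).
Variable B : nat -> T -> bool.

Definition history (t : nat) (c : nat -> 'I_N) (w : nat -> m.-tuple nat)
    (b : nat -> bool) : set T :=
  [set o | forall s, (s < t)%N -> [/\ C s o = c s, W s o = w s & B s o = b s]].

(* (C t, W t, B t) are the community, the chosen neighbours and the type of   *)
(* the vertex added between times t and t + 1. The conditional laws are       *)
(* elementary, all variables being discrete: P (E `&` F) = P E * q stands for *)
(* P (F | E) = q.                                                             *)
Record pa_model (P : probability T R) (mu : 'I_N -> R) (A : 'M[R]_N)
    (p : 'I_m.+1 -> R) (G0 : cgraph N) : Prop := {
  pa_measurable_comm : forall t x, measurable [set o | C t o = x];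
  pa_measurable_nbrs : forall t u, measurable [set o | W t o = u];
  pa_measurable_type : forall t a, measurable [set o | B t o = a];
  pa_law_comm : forall t c w b x,
    P (history t c w b `&` [set o | C t o = x])
    = (P (history t c w b) * (mu x)%:E)%E;
  pa_law_nbrs : forall t c w b x u,
    P (history t c w b `&` [set o | C t o = x] `&` [set o | W t o = u])
    = (P (history t c w b `&` [set o | C t o = x]) *
       (\prod_(j < m) attach_prob A (pa_graph G0 c w b t) x (tnth u j))%:E)%E;
  (* [inord] is only a cast here: the count is at most m. *)
  pa_law_type : forall t c w b x u,
    P (history t c w b `&` [set o | C t o = x] `&` [set o | W t o = u]
       `&` [set o | B t o = true])
    = (P (history t c w b `&` [set o | C t o = x] `&` [set o | W t o = u]) *
       (p (inord (count (red (pa_graph G0 c w b t)) u)))%:E)%E }.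

Definition random_graph (G0 : cgraph N) (t : nat) (o : T) : cgraph N :=
  pa_graph G0 (C^~ o) (W^~ o) (B^~ o) t.

End Realization.

Definition red_proportion (N : nat) (G : cgraph N) (i : 'I_N) : R :=
  (\sum_(v < nvertices G | red G v && (comm G v == i)) deg G v)%N%:R /
  (\sum_(v < nvertices G | comm G v == i) deg G v)%N%:R.

Definition rule_poly (m : nat) (p : 'I_m.+1 -> R) : {poly R} :=
  \sum_(k < m.+1) ('C(m, k)%:R * p k) *: ('X^k * (1 - 'X) ^+ (m - k)).

Definition stable_fixpoint (Q : {poly R}) (z : R) : Prop :=
  Q.[z] = z /\
  [\/ 0 < z < 1 /\ (exists2 eta, 0 < eta &
        (forall y, z - eta < y < z -> y < Q.[y]) /\
        (forall y, z < y < z + eta -> Q.[y] < y)),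
      z = 0 /\ (exists2 eta, 0 < eta & forall y, 0 < y < eta -> Q.[y] < y) |
      z = 1 /\ (exists2 eta, 0 < eta & forall y, 1 - eta < y < 1 -> y < Q.[y])].

Definition linearly_stable (Q : {poly R}) (z : R) : Prop :=
  stable_fixpoint Q z /\ Q^`().[z] < 1.

Definition diag_part (N : nat) (A : 'M[R]_N) : 'M[R]_N :=
  diag_mx (\row_i A i i).

Definition interpolation (N : nat) (A1 : 'M[R]_N) (theta : R) : 'M[R]_N :=
  (1 - theta) *: diag_part A1 + theta *: A1.

(* No community is confined to one type from the start. If p_0 = 0, a red     *)
(* vertex needs a red neighbour, so that community i never has a red vertex   *)
(* unless G0 has one in a community leading to i along positive entries of A; *)
(* likewise for blue vertices if p_m = 1. Otherwise Z_i stays equal to 0, or  *)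
(* to 1, and cannot converge to a different fixed point. There is no          *)
(* condition when p_0 > 0 and p_m < 1.                                        *)
Definition types_accessible (N m : nat) (A : 'M[R]_N) (p : 'I_m.+1 -> R)
    (G0 : cgraph N) : Prop :=
  let leads_to := connect [rel x y | 0 < A x y] in
  forall i,
    (p ord0 = 0 -> exists v,
       [/\ (v < nvertices G0)%N, red G0 v & leads_to (comm G0 v) i]) /\
    (p ord_max = 1 -> exists v,
       [/\ (v < nvertices G0)%N, ~~ red G0 v & leads_to (comm G0 v) i]).

Definition positive_probability (d : measure_display) (T : measurableType d)
    (P : probability T R) (E : set T) : Prop :=
  measurable E /\ (0 < P E)%E.

End Model.

(* Main.v *)
Require Import Defs.
From HB Require Import structures.
From mathcomp Require Import all_boot all_order all_algebra.
From mathcomp Require Import all_classical all_reals all_analysis.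
From mathcomp Require Import ring lra zify polyrcf.

Set Implicit Arguments.
Unset Strict Implicit.
Unset Printing Implicit Defensive.

Import Order.TTheory GRing.Theory Num.Theory.
Import numFieldNormedType.Exports.

Local Open Scope classical_set_scope.
Local Open Scope ring_scope.

(** The process follows, up to noise, a deterministic dynamics driven with step
1/n, where n is the number of vertices. Write D_i for the total degree of
community i, X_i = D_i / (2mn) for its share of the edge-ends, and Z_i for the
proportion of its edge-ends that are red. A newcomer of community y attaches an
edge to community u with probability share u y, which is proportional to
A u y * X_u, and to a red vertex with probability q_y = mixture y, the average
of the Z_u with these weights. Edges received by community i are red with
probability Z_i and do not move Z_i in the mean; so only newcomers of community
i do, and they pull Z_i towards R(q_i), while X is pulled towards the inflow.

If the communities do not interact, then q_i = Z_i and the inflow is mu, so that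
(mu, z) is an equilibrium. For small theta the off-diagonal shares are theta
times a bounded Lipschitz function (weak_coupling), and the contraction principle
gives an equilibrium (Xs, Zs) near (mu, z) (equilibrium_exists). Linear stability,
R'(z_i) < 1, makes it attracting: the energy
V = sum_i (X_i - Xs_i)^2 + (X_i (Z_i - Zs_i))^2 decreases along the dynamics near
it (drift_negative), hence the mean of V after one step is at most
V - 2 c V / (n + 1) + C / (n + 1)^2 (energy_step).

Now let g(n) = 1 + gamma (1/(n_0 + 1) + ... + 1/n) with gamma small. As long as V
is small, g(n) (V + 4 C / (n - 1)) decreases in the mean
(multiplier_supermartingale). By the maximal inequality (never_bad_positive), if
V is small enough at a late time n_0, then with positive probability g V stays
for ever below a fixed level. On this one event the process does not leave the
region where the estimates hold, and V tends to 0 because g is unbounded. Thus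
Z converges to Zs.

It remains to reach such a state by a history of positive probability
(target_attainable). Both colours are first brought into every community, along
the positive entries of A. Afterwards newcomers attach within their community.
Since z_i is a fixed point of R, a newcomer whose number of red neighbours is
binomial with parameter z_i brings 2 m z_i red edge-ends in the mean; so some
possible choice brings at least, and another at most, this number
(increment_above, increment_below). Taking each time a choice that compensates
the current excess keeps both D_i - 2 m n mu_i and the red excess of community i
bounded, while n grows. *)

(** * Sampling with replacement *)

Section Sampling.
Context {R : realType} {V : finType} (a : V -> R) (m : nat).
Hypothesis a1 : \sum_v a v = 1.

Lemma sample_prod (F : 'I_m -> V -> R) :
  \sum_(u : {ffun 'I_m -> V}) (\prod_j a (u j)) * (\prod_j F j (u j)) =
  \prod_j \sum_v a v * F j v.
Proof.
rewrite bigA_distr_bigA /=; apply: eq_bigr => u _.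
by rewrite big_split.
Qed.

Lemma sample_total : \sum_(u : {ffun 'I_m -> V}) \prod_j a (u j) = 1.
Proof.
by rewrite -(bigA_distr_bigA (fun=> a)) big1.
Qed.

Lemma sample_mean (f : V -> R) :
  \sum_(u : {ffun 'I_m -> V}) (\prod_j a (u j)) * (\sum_j f (u j)) =
  m%:R * \sum_v a v * f v.
Proof.
under eq_bigr do rewrite big_distrr /=.
rewrite exchange_big /= (eq_bigr (fun=> \sum_v a v * f v)); last first.
  move=> i _.
  transitivity (\prod_(j < m) \sum_v a v * (if j == i then f v else 1)).
    rewrite -sample_prod; apply: eq_bigr => u _; congr (_ * _).
    rewrite (bigD1 i) //= eqxx [X in _ * X]big1 ?mulr1// => j /negbTE ->.
    by [].
  rewrite (bigD1 i) //= eqxx [X in _ * X]big1 ?mulr1// => j /negbTE ->.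
  by under eq_bigr do rewrite mulr1.
by rewrite sumr_const card_ord mulr_natl.
Qed.

(** The number of hits is binomial. The generating polynomial of the left-hand
side factorizes as (q X + 1 - q)^m, whose coefficients are compared. *)
Lemma sample_count (S : pred V) (f : nat -> R) (q := \sum_(v | S v) a v) :
  \sum_(u : {ffun 'I_m -> V}) (\prod_j a (u j)) * f (\sum_j S (u j))%N =
  \sum_(k < m.+1) 'C(m, k)%:R * (q ^+ k * (1 - q) ^+ (m - k)) * f k.
Proof.
pose gen : {poly R} :=
  \sum_(u : {ffun 'I_m -> V}) (\prod_j a (u j))%:P * 'X^(\sum_j S (u j)).
have genE : gen = (q *: 'X + (1 - q)%:P) ^+ m.
  transitivity (\prod_(j < m) \sum_v (a v)%:P * 'X^(S v) : {poly R}).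
    rewrite bigA_distr_bigA /=; apply: eq_bigr => u _.
    by rewrite big_split /= rmorph_prod /= -expr_sum.
  rewrite prodr_const card_ord; congr (_ ^+ _).
  rewrite (bigID S) /=; congr (_ + _).
    rewrite /q scaler_suml; apply: eq_bigr => v ->.
    by rewrite expr1 mul_polyC.
  have -> : 1 - q = \sum_(v | ~~ S v) a v.
    by rewrite -a1 (bigID S) /= -/q addrAC subrr add0r.
  rewrite rmorph_sum /=.
  by apply: eq_bigr => v /negbTE ->; rewrite expr0 mulr1.
have genk k : gen`_k =
    \sum_(u : {ffun 'I_m -> V}) (\prod_j a (u j)) * (k == \sum_j S (u j))%N%:R.
  rewrite coef_sum; apply: eq_bigr => u _.
  by rewrite coefCM coefXn.
have genb (k : 'I_m.+1) : gen`_k = 'C(m, k)%:R * (q ^+ k * (1 - q) ^+ (m - k)).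
  rewrite genE addrC exprDn coef_sum (bigD1 k) //= big1.
    rewrite addr0 coefMn -polyC_exp coefCM exprZn coefZ coefXn eqxx mulr1.
    by rewrite -mulr_natl; ring.
  move=> i ik; rewrite coefMn -polyC_exp coefCM exprZn coefZ coefXn.
  rewrite (_ : (k == i :> nat) = false) ?mulr0 ?mul0rn//.
  by apply/negbTE; rewrite eq_sym.
transitivity (\sum_(k < m.+1) gen`_k * f k); last first.
  by apply: eq_bigr => k _; rewrite genb.
under [RHS]eq_bigr do rewrite genk mulr_suml.
rewrite exchange_big /=; apply: eq_bigr => u _.
have le_m : (\sum_j S (u j) < m.+1)%N.
  rewrite ltnS; apply: (@leq_trans (\sum_(j < m) 1)).
    by apply: leq_sum => j _; case: (S _).
  by rewrite sum_nat_const card_ord muln1.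
rewrite (bigD1 (Ordinal le_m)) //= eqxx mulr1 [X in _ + X]big1 ?addr0// => k.
move=> /negbTE; rewrite -val_eqE /= => ->.
by rewrite mulr0 mul0r.
Qed.

End Sampling.

Arguments sample_total {R V a} m.
Arguments sample_mean {R V a} m.
Arguments sample_count {R V a} m.

(** * Degrees and attachment probabilities *)

Section Degrees.
Context {N : nat}.
Implicit Types (G : cgraph N) (Q : pred nat) (i x : 'I_N).

Definition degree_sum G Q : nat := (\sum_(v < nvertices G | Q v) deg G v)%N.

Definition comm_degree G i := degree_sum G (fun v => comm G v == i).

Definition red_degree G i :=
  degree_sum G (fun v => red G v && (comm G v == i)).

Definition endpoints_ok G := forall e, e \in edges G ->
  (e.1 < nvertices G)%N /\ (e.2 < nvertices G)%N.

(** Counting edge by edge rather than vertex by vertex makes the effect of a new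
vertex additive, since its edges are appended to the list. *)
Lemma degree_sumE G Q : endpoints_ok G ->
  degree_sum G Q = (\sum_(e <- edges G) (Q e.1 + Q e.2))%N.
Proof.
rewrite /degree_sum /deg /endpoints_ok.
elim: (edges G) => [|e s IHs] ok.
  by rewrite big_nil big1.
rewrite big_cons -IHs; last by move=> e' es; apply: ok; rewrite inE es orbT.
have single (k : nat) : (k < nvertices G)%N ->
    (\sum_(v < nvertices G | Q v) (k == v))%N = Q k.
  move=> kn; rewrite big_mkcond (bigD1 (Ordinal kn)) //= eqxx big1 ?addn0.
    by case: (Q k).
  by move=> v /negbTE; rewrite -val_eqE eq_sym /= => ->; rewrite if_same.
have [e1 e2] := ok e (mem_head _ _).
rewrite -[in RHS](single _ e1) -[in RHS](single _ e2) -!big_split /=.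
by apply: eq_bigr => v _; lia.
Qed.

Lemma degree_sum_gt0 G Q : (0 < degree_sum G Q)%N ->
  exists v, [/\ (v < nvertices G)%N, Q v & (0 < deg G v)%N].
Proof.
rewrite lt0n sum_nat_eq0 negb_forall => /existsP[v].
by rewrite negb_imply -lt0n => /andP[Qv dv]; exists v.
Qed.

Lemma degree_sum_ge G Q v : (v < nvertices G)%N -> Q v ->
  (deg G v <= degree_sum G Q)%N.
Proof.
by move=> vn Qv; rewrite /degree_sum (bigD1 (Ordinal vn)) //= leq_addr.
Qed.

Lemma deg_notin G v : endpoints_ok G -> ~~ (v < nvertices G)%N -> deg G v = 0%N.
Proof.
move=> ok vn; rewrite /deg; apply/eqP; rewrite addn_eq0.
by apply/andP; split; rewrite eqn0Ngt -has_count; apply/hasPn => e /ok[e1 e2];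
  apply: contra vn => /eqP <-.
Qed.

Lemma red_degree_le G i : (red_degree G i <= comm_degree G i)%N.
Proof.
rewrite /red_degree /comm_degree /degree_sum [leqRHS](bigID (fun v : 'I__ => red G v)) /=.
by rewrite (eq_bigl _ _ (fun v => andbC _ _)) leq_addr.
Qed.

(** The properties of the initial graph that every later graph keeps. *)
Record proper m G : Prop := {
  proper_endpoints : endpoints_ok G;
  proper_size : size (edges G) = (m * nvertices G)%N;
  proper_nonempty : forall i, (0 < comm_degree G i)%N }.

Lemma comm_degree_total m G : proper m G ->
  (\sum_i comm_degree G i = 2 * m * nvertices G)%N.
Proof.
case=> ok sz _; rewrite -mulnA -sz.
transitivity (\sum_i \sum_(e <- edges G) ((comm G e.1 == i) + (comm G e.2 == i)))%N.
  by apply: eq_bigr => i _; rewrite /comm_degree degree_sumE.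
rewrite exchange_big /= (eq_bigr (fun=> 2%N)).
  by rewrite big_const_seq count_predT iter_addn_0.
move=> e _.
have one (j : 'I_N) : (\sum_i (j == i))%N = 1%N.
  by rewrite (bigD1 j) //= eqxx big1 // => i /negbTE; rewrite eq_sym => ->.
by rewrite big_split /= !one.
Qed.

Lemma initial_proper m G : initial_graph m G -> proper m G.
Proof.
case=> ok sz dg cm; split=> // i; have [v vn ci] := cm i.
by apply: leq_trans (dg v vn) _; apply: degree_sum_ge => //; rewrite ci.
Qed.

Section AddVertex.
Context {m : nat} (G : cgraph N) (x : 'I_N) (w : m.-tuple nat) (b : bool).
Hypothesis prG : proper m G.
Hypothesis w_lt : forall v, v \in w -> (v < nvertices G)%N.

Let G' := add_vertex G x w b.

Lemma add_vertex_endpoints : endpoints_ok G'.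
Proof.
move=> e; rewrite mem_cat => /orP[eG|/mapP[v vw ->]] /=.
  by have [e1 e2] := proper_endpoints prG eG; split; apply: ltnW.
by split; [exact: ltnSn | apply/ltnW/w_lt].
Qed.

Lemma degree_sum_add Q Q' :
  (forall v, (v < nvertices G)%N -> Q' v = Q v) ->
  degree_sum G' Q' =
  (degree_sum G Q + m * Q' (nvertices G) + \sum_(v <- w) Q v)%N.
Proof.
move=> QQ.
rewrite (degree_sumE _ add_vertex_endpoints) (degree_sumE _ (proper_endpoints prG)).
rewrite /= big_cat /= -addnA; congr (_ + _)%N.
  apply: eq_big_seq => e eG.
  by have [e1 e2] := proper_endpoints prG eG; rewrite !QQ.
rewrite big_map big_split /=; congr (_ + _)%N.
  by rewrite big_const_seq count_predT iter_addn_0 size_tuple mulnC.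
by apply: eq_big_seq => v vw; rewrite QQ ?w_lt.
Qed.

Lemma comm_degree_add i : comm_degree G' i =
  (comm_degree G i + m * (x == i) + \sum_(v <- w) (comm G v == i))%N.
Proof.
rewrite /comm_degree (@degree_sum_add (fun v => comm G v == i)) /= ?eqxx //.
by move=> v vn; rewrite ltn_eqF.
Qed.

Lemma red_degree_add i : red_degree G' i =
  (red_degree G i + m * (b && (x == i)) +
   \sum_(v <- w) (red G v && (comm G v == i)))%N.
Proof.
rewrite /red_degree.
rewrite (@degree_sum_add (fun v => red G v && (comm G v == i))) /= ?eqxx //.
by move=> v vn; rewrite ltn_eqF.
Qed.

Lemma add_vertex_proper : proper m G'.
Proof.
split; first exact: add_vertex_endpoints.
  by rewrite /= size_cat size_map size_tuple (proper_size prG) mulnS addnC.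
move=> i; rewrite comm_degree_add.
by have := proper_nonempty prG i; lia.
Qed.

End AddVertex.

Lemma proper_nvertices_gt0 m G (i : 'I_N) : proper m G -> (0 < nvertices G)%N.
Proof.
by case=> _ _ /(_ i) /degree_sum_gt0[v []]; case: (nvertices G).
Qed.

End Degrees.

Section Attachment.
Context {R : realType} {N : nat}.
Implicit Types (A : 'M[R]_N) (X Z mu : 'I_N -> R) (G : cgraph N).

(** The law of the community chosen by an edge of a newcomer of community [y]. It
is invariant under scaling of [X], so that degrees may stand for proportions of
edge-ends. *)
Definition share A X (u y : 'I_N) : R := A u y * X u / \sum_w A w y * X w.

Definition mixture A X Z (y : 'I_N) : R := \sum_u share A X u y * Z u.

(** The expected fraction of the 2m edge-ends of a newcomer that fall into
community [i]: m of them are at the newcomer, m at its neighbours. *)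
Definition inflow A mu X (i : 'I_N) : R :=
  (mu i + \sum_y mu y * share A X i y) / 2.

Definition weight G (i : 'I_N) : R := (comm_degree G i)%:R.

Lemma attach_denominator A G y :
  \sum_(u < nvertices G) A (comm G u) y * (deg G u)%:R =
  \sum_x A x y * weight G x.
Proof.
rewrite (partition_big (fun u : 'I__ => comm G u) xpredT) //=.
apply: eq_bigr => x _; rewrite /weight /comm_degree /degree_sum natr_sum mulr_sumr.
by apply: eq_bigr => u /eqP ->.
Qed.

Lemma attach_sum A G y (Q : pred nat) i :
  \sum_(v < nvertices G | Q v && (comm G v == i)) attach_prob A G y v =
  A i y * (degree_sum G (fun v => Q v && (comm G v == i)))%:R /
  \sum_x A x y * weight G x.
Proof.
rewrite /attach_prob attach_denominator -mulr_suml; congr (_ / _).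
rewrite natr_sum mulr_sumr.
by apply: eq_bigr => v /andP[_ /eqP ->].
Qed.

Lemma attach_sum_comm A G y i :
  \sum_(v < nvertices G | comm G v == i) attach_prob A G y v =
  share A (weight G) i y.
Proof. exact: (attach_sum A G y xpredT i). Qed.

Lemma red_proportionE G i :
  red_proportion R G i = (red_degree G i)%:R / weight G i.
Proof. by []. Qed.

Lemma weight_gt0 m G i : proper m G -> 0 < weight G i.
Proof. by move=> pr; rewrite ltr0n; case: pr. Qed.

Lemma red_degree_proportion m G i : proper m G ->
  (red_degree G i)%:R = red_proportion R G i * weight G i.
Proof.
by move=> pr; rewrite red_proportionE divfK // gt_eqF // (weight_gt0 _ pr).
Qed.

Lemma attach_sum_red_comm m A G y i : proper m G ->
  \sum_(v < nvertices G | red G v && (comm G v == i)) attach_prob A G y v =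
  share A (weight G) i y * red_proportion R G i.
Proof.
move=> pr; rewrite attach_sum -/(red_degree G i) (red_degree_proportion _ pr).
by rewrite /share; ring.
Qed.

Lemma attach_sum_red m A G y : proper m G ->
  \sum_(v < nvertices G | red G v) attach_prob A G y v =
  mixture A (weight G) (red_proportion R G) y.
Proof.
move=> pr; rewrite (partition_big (fun u : 'I__ => comm G u) xpredT) //=.
by apply: eq_bigr => i _; rewrite (attach_sum_red_comm _ _ _ pr).
Qed.

Definition positive_diagonal A :=
  (forall x y, 0 <= A x y) /\ (forall i, 0 < A i i).

Lemma mass_gt0 A X y : positive_diagonal A -> (forall i, 0 < X i) ->
  0 < \sum_x A x y * X x.
Proof.
move=> [A0 Ad] X0; rewrite (bigD1 y) //= ltr_pwDl ?mulr_gt0 //.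
by apply: sumr_ge0 => i _; rewrite mulr_ge0 // ltW.
Qed.

Lemma share_total A X y : positive_diagonal A -> (forall i, 0 < X i) ->
  \sum_u share A X u y = 1.
Proof.
by move=> pA X0; rewrite -mulr_suml divff // gt_eqF // mass_gt0.
Qed.

Lemma share_scale A X u y (c : R) : c != 0 ->
  share A (fun i => X i / c) u y = share A X u y.
Proof.
move=> c0; rewrite /share mulrA.
have -> : \sum_w A w y * (X w / c) = (\sum_w A w y * X w) / c.
  by rewrite mulr_suml; apply: eq_bigr => w _; rewrite mulrA.
by rewrite invf_div mulrA mulfVK.
Qed.

Lemma attach_prob_ge0 A G y v : positive_diagonal A -> 0 <= attach_prob A G y v.
Proof.
move=> [A0 _]; rewrite divr_ge0 ?mulr_ge0 //.
by apply: sumr_ge0 => u _; rewrite mulr_ge0.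
Qed.

Lemma attach_prob_gt0 m A G y v : positive_diagonal A -> proper m G ->
  0 < A (comm G v) y -> (0 < deg G v)%N -> 0 < attach_prob A G y v.
Proof.
move=> pA pr Av dv; rewrite divr_gt0 ?mulr_gt0 ?ltr0n //.
by rewrite attach_denominator mass_gt0 // => i; apply: weight_gt0 pr.
Qed.

Lemma attach_prob_notin A G y v : endpoints_ok G -> ~~ (v < nvertices G)%N ->
  attach_prob A G y v = 0.
Proof. by move=> ok vn; rewrite /attach_prob deg_notin // mulr0 mul0r. Qed.

Lemma attach_total m A G y : positive_diagonal A -> proper m G ->
  \sum_(v < nvertices G) attach_prob A G y v = 1.
Proof.
move=> pA pr; rewrite (partition_big (fun u : 'I__ => comm G u) xpredT) //=.
rewrite (eq_bigr (fun i => share A (weight G) i y)).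
  by rewrite share_total // => i; apply: weight_gt0 pr.
by move=> i _; rewrite attach_sum_comm.
Qed.

End Attachment.

(** * The maximal inequality *)

Section StepMean.
Context {R : realType} {N m : nat}.
Variables (mu : 'I_N -> R) (A : 'M[R]_N) (p : 'I_m.+1 -> R).
Implicit Type G : cgraph N.

Definition neighbours n (u : {ffun 'I_m -> 'I_n}) : m.-tuple nat :=
  [tuple (u j : nat) | j < m].

Definition red_chance G (w : seq nat) : R := p (inord (count (red G) w)).

Definition type_chance G (w : seq nat) (b : bool) : R :=
  if b then red_chance G w else 1 - red_chance G w.

(** The conditional expectation of a function of the next graph. It is a finite
sum, so that the estimates on the mean need no integration. *)
Definition step_mean G (F : cgraph N -> R) : R :=
  \sum_x mu x * \sum_(u : {ffun 'I_m -> 'I_(nvertices G)})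
    (\prod_j attach_prob A G x (u j)) *
    \sum_b type_chance G (neighbours u) b * F (add_vertex G x (neighbours u) b).

(** The graphs that the process can produce with positive probability. *)
Inductive attainable (G0 : cgraph N) : nat -> cgraph N -> Prop :=
| attainable0 : attainable G0 0 G0
| attainableS t G x (w : m.-tuple nat) b :
    attainable G0 t G -> 0 < mu x ->
    (forall v, v \in w -> 0 < attach_prob A G x v) ->
    0 < type_chance G w b -> attainable G0 t.+1 (add_vertex G x w b).

Lemma neighbours_lt n (u : {ffun 'I_m -> 'I_n}) v :
  v \in neighbours u -> (v < n)%N.
Proof. by case/tnthP => j ->; rewrite tnth_mktuple. Qed.

End StepMean.

Section Realization.
Context {R : realType} {N m : nat} {d : measure_display} {T : measurableType d}.
Variables (P : probability T R) (C : nat -> T -> 'I_N).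
Variables (W : nat -> T -> m.-tuple nat) (B : nat -> T -> bool).
Variables (mu : 'I_N -> R) (A : 'M[R]_N) (p : 'I_m.+1 -> R) (G0 : cgraph N).
Hypothesis model : pa_model C W B P mu A p G0.

Let hist := history C W B.
Let graph t (o : T) := random_graph C W B G0 t o.

Lemma pa_graph_eq t c w b c' w' b' :
  (forall s, (s < t)%N -> [/\ c s = c' s, w s = w' s & b s = b' s]) ->
  pa_graph (m := m) G0 c w b t = pa_graph G0 c' w' b' t.
Proof.
elim: t => //= t IHt eqs; have [-> -> ->] := eqs t (ltnSn t).
by rewrite IHt // => s st; apply: eqs; apply: ltnW.
Qed.

Lemma history_graph t c w b o : hist t c w b o -> graph t o = pa_graph G0 c w b t.
Proof. by move=> ho; apply: pa_graph_eq => s /ho. Qed.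

Definition override {E : Type} (f : nat -> E) t e := fun s => if s == t then e else f s.

Lemma history_override t c w b x u a :
  hist t.+1 (override c t x) (override w t u) (override b t a) =
  hist t c w b `&` [set o | C t o = x] `&` [set o | W t o = u]
    `&` [set o | B t o = a].
Proof.
apply/seteqP; split=> o /=.
  move=> ho; have := ho t (ltnSn t); rewrite /override eqxx => -[-> -> ->].
  split=> //; split=> //; split=> // s st.
  by have := ho s (ltnW st); rewrite /override (ltn_eqF st).
move=> [[[ho Cx] Wu] Ba] s; rewrite ltnS leq_eqVlt /override => /orP[/eqP->|st].
  by rewrite eqxx.
by rewrite ltn_eqF //; apply: ho.
Qed.

Lemma graph_override t c w b x (u : m.-tuple nat) a :
  pa_graph G0 (override c t x) (override w t u) (override b t a) t.+1 =
  add_vertex (pa_graph G0 c w b t) x u a.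
Proof.
rewrite /= /override eqxx; congr (@add_vertex N m _ _ _ _); apply: pa_graph_eq => s st /=.
by rewrite ltn_eqF.
Qed.

Lemma measurable_history t c w b : measurable (hist t c w b).
Proof.
elim: t => [|t IHt]; first by rewrite (_ : hist 0 _ _ _ = setT) //; apply/seteqP; split.
have -> : hist t.+1 c w b = hist t.+1 (override c t (c t)) (override w t (w t))
    (override b t (b t)).
  by apply/seteqP; split=> o ho s st; have := ho s st; rewrite /override;
    case: eqP => // ->.
rewrite history_override; do 3?[apply: measurableI => //].
- exact: pa_measurable_comm model _ _.
- exact: pa_measurable_nbrs model _ _.
- exact: pa_measurable_type model _ _.
Qed.

(** The random data up to a given time take countably many values. *)
Lemma measurable_graph t (Q : cgraph N -> Prop) : measurable [set o | Q (graph t o)].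
Proof.
elim: t Q => [|t IHt] Q.
  have [q|nq] := pselect (Q G0).
    by rewrite (_ : [set _ | _] = setT) //; apply/seteqP; split.
  by rewrite (_ : [set _ | _] = set0) //; apply/seteqP; split.
pose F (k : 'I_N * m.-tuple nat * bool) := [set o | C t o = k.1.1] `&`
  [set o | W t o = k.1.2] `&` [set o | B t o = k.2] `&`
  [set o | Q (add_vertex (graph t o) k.1.1 k.1.2 k.2)].
rewrite (_ : [set o | _] = \bigcup_k F k).
  apply: countable_bigcupT_measurable => [|k]; first exact: countableP.
  apply: measurableI; last exact: (IHt (fun G => Q (add_vertex G k.1.1 k.1.2 k.2))).
  apply: measurableI; last exact: (pa_measurable_type model).
  by apply: measurableI; [exact: (pa_measurable_comm model)|
    exact: (pa_measurable_nbrs model)].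
apply/seteqP; split=> o /=; first by move=> q; exists (C t o, W t o, B t o).
by move=> [[[x u] a] _] [[[/= Cx Wu] Ba]]; rewrite -Cx -Wu -Ba.
Qed.

Lemma law_step t c w b x u a :
  P (hist t.+1 (override c t x) (override w t u) (override b t a)) =
  (P (hist t c w b) *
   (mu x * (\prod_(j < m) attach_prob A (pa_graph G0 c w b t) x (tnth u j)) *
    type_chance p (pa_graph G0 c w b t) u a)%:E)%E.
Proof.
rewrite history_override.
have mC := pa_measurable_comm model t x; have mW := pa_measurable_nbrs model t u.
have mH := measurable_history t c w b.
have lawW := pa_law_nbrs model t c w b x u.
rewrite (pa_law_comm model) -muleA -EFinM in lawW.
have lawB := pa_law_type model t c w b x u; rewrite lawW -muleA -EFinM in lawB.
case: a; first by rewrite lawB.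
set H3 := hist _ _ _ _ `&` _ `&` _; rewrite (_ : _ `&` _ = H3 `\` [set o | B t o = true]).
  have mH3 : measurable H3 by do 2?[apply: measurableI => //].
  rewrite measureD //; last 2 first.
  - exact: (pa_measurable_type model).
  - by rewrite (le_lt_trans (probability_le1 _ _)) ?ltry.
  apply: etrans (congr2 (fun a b => (a - b)%E) lawW lawB) _.
  rewrite -[P (hist _ _ _ _)]fineK ?fin_num_measure // -!EFinM -EFinB; congr EFin.
  by rewrite /= /red_chance; ring.
apply/seteqP; split=> o [H3o /= Bo]; split=> //=; first by rewrite Bo.
by case: (B t o) Bo.
Qed.

Lemma attainable_realized t G : attainable mu A p G0 t G ->
  exists c w b, pa_graph G0 c w b t = G /\ (0 < P (hist t c w b))%E.
Proof.
elim=> [|{}t {}G x u a _ [c [w [b [<- Pgt0]]]] mux uA ch].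
  have [pt _] : exists pt : T, True.
    apply: contrapT => noT; have T0 : [set: T] = set0.
      by apply/seteqP; split=> // o; case: noT; exists o.
    have := probability_setT P.
    by rewrite T0 measure0 => /eqP; rewrite eq_sym onee_eq0.
  exists (C^~ pt), (W^~ pt), (B^~ pt); split=> //.
  rewrite (_ : hist 0 _ _ _ = setT) ?probability_setT ?lte01 //.
  by apply/seteqP; split.
exists (override c t x), (override w t u), (override b t a).
rewrite graph_override; split=> //.
rewrite law_step mule_gt0 // lte_fin !mulr_gt0 // prodr_gt0 // => j _.
by apply: uA; apply: mem_tnth.
Qed.

Lemma finite_union_bound (K : finType) (F : K -> set T) (E Z : set T) :
  measurable E -> (forall k, measurable (F k)) -> measurable Z -> P Z = 0%E ->
  E `<=` Z `|` \bigcup_k F k ->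
  (P E <= \sum_k P (F k))%E.
Proof.
move=> mE mF mZ Z0 EF.
have bound (s : seq K) : measurable (\big[setU/set0]_(k <- s) F k) /\
    (P (\big[setU/set0]_(k <- s) F k) <= \sum_(k <- s) P (F k))%E.
  elim: s => [|k s [ms IHs]]; first by rewrite !big_nil measure0; split.
  rewrite !big_cons; split; first exact: measurableU.
  by apply: le_trans (measureU2 _ _ _) _ => //; rewrite leeD2l.
have [mU leU] := bound (index_enum K).
apply: (@le_trans _ _ (P Z + P (\big[setU/set0]_(k <- index_enum K) F k))%E);
  last by rewrite Z0 add0e.
apply: le_trans (measureU2 _ mZ mU).
apply: le_measure; rewrite ?inE //; first exact: measurableU.
move=> o /EF[Zo|[k _ Fo]]; [by left | right].
by rewrite -bigcup_seq; exists k => //=; rewrite mem_index_enum.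
Qed.

Section MaximalInequality.
Variables (I : cgraph N -> Prop) (bad : cgraph N -> Prop) (L : cgraph N -> R).
Hypothesis I_endpoints : forall G, I G -> endpoints_ok G.
Hypothesis I_add : forall G x (w : m.-tuple nat) b, I G ->
  (forall v, v \in w -> (v < nvertices G)%N) -> I (add_vertex G x w b).
Hypothesis L_ge0 : forall G, I G -> 0 <= L G.
Hypothesis L_bad : forall G, I G -> bad G -> 1 <= L G.
Hypothesis L_super : forall G, I G -> ~ bad G -> step_mean mu A p G L <= L G.

Let bad_within k t := [set o | exists2 s, (t <= s <= t + k)%N & bad (graph s o)].

Lemma measurable_bad_within k t : measurable (bad_within k t).
Proof.
rewrite (_ : bad_within k t =
    \bigcup_(s in [set s | (t <= s <= t + k)%N]) [set o | bad (graph s o)]).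
  by apply: bigcup_measurable => s _; apply: measurable_graph.
by apply/seteqP; split=> o [s]; exists s.
Qed.

(** Neighbours are arbitrary numbers in the model; those that are not vertices
have degree 0 and are chosen with probability 0. *)
Lemma neighbours_outside_null t c w b : I (pa_graph G0 c w b t) ->
  P (hist t c w b `&`
     [set o | exists2 v, v \in W t o & ~~ (v < nvertices (pa_graph G0 c w b t))%N]) = 0%E.
Proof.
set G := pa_graph _ _ _ _ _ => IG.
pose out (u : m.-tuple nat) := exists2 v, v \in u & ~~ (v < nvertices G)%N.
pose F (k : 'I_N * m.-tuple nat) := if pselect (out k.2) then
   hist t c w b `&` [set o | C t o = k.1] `&` [set o | W t o = k.2] else set0.
have mF k : measurable (F k).
  rewrite /F; case: pselect => h /=; last exact: measurable0.
  do 2?[apply: measurableI].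
  - exact: measurable_history.
  - exact: (pa_measurable_comm model).
  - exact: (pa_measurable_nbrs model).
have F0 k : P (F k) = 0%E.
  rewrite /F; case: pselect => /= [outk|_]; last exact: measure0.
  case: outk => v vk vn.
  rewrite (pa_law_nbrs model); case/tnthP: vk => j vj.
  rewrite (bigD1 j) //= -vj attach_prob_notin ?mul0r ?mule0 //.
  exact: I_endpoints.
rewrite (_ : _ `&` _ = \bigcup_n (if unpickle n is Some k then F k else set0)).
  have mFn n : measurable (if unpickle n is Some k then F k else set0).
    by case: unpickle.
  apply/negligibleP; first exact: bigcup_measurable.
  apply: negligible_bigcup => n; apply/negligibleP => //.
  by case: unpickle => // *; rewrite measure0.
apply/seteqP; split=> o /=.
  move=> [ho [v vW vn]]; exists (pickle (C t o, W t o)) => //=.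
  by rewrite pickleK /F; case: pselect => [h|[]]; last by exists v.
move=> [n _]; case: unpickle => // -[x u]; rewrite /F; case: pselect => //= outu; case: outu.
by move=> v vu vn [[ho _] Wu]; split=> //; exists v; rewrite ?Wu.
Qed.

(** Doob's maximal inequality for the nonnegative function [L], by induction on
the horizon: either the graph is already bad and [L] is at least 1 there, or the
first step is averaged and [L_super] applies. *)
Lemma maximal_inequality_within k t c w b : I (pa_graph G0 c w b t) ->
  (P (hist t c w b `&` bad_within k t) <=
   P (hist t c w b) * (L (pa_graph G0 c w b t))%:E)%E.
Proof.
elim: k t c w b => [|k IHk] t c w b; set G := pa_graph _ _ _ _ _ => IG.
all: have mH := measurable_history t c w b.
all: have mE l := @measurableI _ _ _ _ mH (measurable_bad_within l t).
all: have [badG|goodG] := pselect (bad G).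
1,3: apply: (@le_trans _ _ (P (hist t c w b))); first by
  apply: le_measure; rewrite ?inE.
1,2: by rewrite -[leLHS]mule1 lee_wpmul2l ?lee_fin ?measure_ge0 // L_bad.
  rewrite (_ : _ `&` _ = set0) ?measure0 ?mule_ge0 ?lee_fin ?L_ge0 //.
  apply/seteqP; split=> // o [ho [s]]; rewrite addn0 -eqn_leq => /eqP <-.
  by rewrite (history_graph ho).
pose H' (l : 'I_N * {ffun 'I_m -> 'I_(nvertices G)} * bool) :=
  hist t.+1 (override c t l.1.1) (override w t (neighbours l.1.2)) (override b t l.2).
pose F l := H' l `&` bad_within k t.+1.
set null := hist t c w b `&` [set o | exists2 v, v \in W t o & ~~ (v < nvertices G)%N].
have null0 : P null = 0%E by apply: neighbours_outside_null.
have mnull : measurable null.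
  apply: measurableI => //.
  rewrite (_ : [set o | _] = \bigcup_(u in [set u : m.-tuple nat |
      exists2 v, v \in u & ~~ (v < nvertices G)%N]) [set o | W t o = u]).
    rewrite bigcup_mkcond; apply: countable_bigcupT_measurable => [|u]; first exact: countableP.
    by case: ifP => // _; apply: (pa_measurable_nbrs model).
  by apply/seteqP; split=> o /= [u]; [exists (W t o) => //; exists u | move=> h ->].
have mF l : measurable (F l).
  by apply: measurableI; [exact: measurable_history | exact: measurable_bad_within].
have cover : (P (hist t c w b `&` bad_within k.+1 t) <= \sum_l P (F l))%E.
  apply: (finite_union_bound _ _ mnull) => //.
  move=> o [ho [s st badt]].
  have [[v vW vn]|inW] := pselect (exists2 v, v \in W t o & ~~ (v < nvertices G)%N).
    by left; split=> //; exists v.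
  have lt_n (j : 'I_m) : (tnth (W t o) j < nvertices G)%N.
    by apply/negP => /negP nlt; apply: inW; exists (tnth (W t o) j); rewrite ?mem_tnth.
  pose u := [ffun j => Ordinal (lt_n j)] : {ffun 'I_m -> 'I_(nvertices G)}.
  right; exists (C t o, u, B t o) => //=; split.
    rewrite /H' history_override /=; do 3?[split=> //=].
    by apply: eq_from_tnth => j; rewrite tnth_mktuple ffunE.
  exists s => //; case/andP: st => ts st; rewrite addSnnS st andbT ltn_neqAle ts andbT.
  apply: contra_not_neq goodG => ets.
  by rewrite /G -(history_graph ho) ets.
apply: le_trans cover _.
have le_term : (\sum_l P (F l) <=
  \sum_(l : 'I_N * {ffun 'I_m -> 'I_(nvertices G)} * bool) (P (hist t c w b) *
   (mu l.1.1 * (\prod_j attach_prob A G l.1.1 (l.1.2 j)) *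
    type_chance p G (neighbours l.1.2) l.2 *
    L (add_vertex G l.1.1 (neighbours l.1.2) l.2))%:E))%E.
  apply: lee_sum => -[[x u] a] _ /=; rewrite /F.
  apply: le_trans (IHk _ _ _ _ _) _.
    rewrite graph_override; apply: I_add => // v; exact: neighbours_lt.
  rewrite graph_override law_step -muleA -EFinM.
  by under [in leLHS]eq_bigr do rewrite tnth_mktuple.
apply: le_trans le_term _; rewrite -[P (hist _ _ _ _)]fineK ?fin_num_measure //.
under eq_bigr do rewrite -EFinM.
rewrite sumEFin -mulr_sumr -EFinM lee_fin ler_wpM2l ?fine_ge0 //.
apply: le_trans (L_super IG goodG); rewrite /step_mean.
rewrite le_eqVlt; apply/orP; left; apply/eqP.
rewrite -(pair_bigA _ (fun (q : 'I_N * {ffun 'I_m -> 'I_(nvertices G)}) a =>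
    mu q.1 * (\prod_j attach_prob A G q.1 (q.2 j)) *
    type_chance p G (neighbours q.2) a *
    L (add_vertex G q.1 (neighbours q.2) a))) /=.
rewrite -(pair_bigA _ (fun x (u : {ffun 'I_m -> 'I_(nvertices G)}) =>
    \sum_a mu x * (\prod_j attach_prob A G x (u j)) *
    type_chance p G (neighbours u) a *
    L (add_vertex G x (neighbours u) a))) /=.
apply: eq_bigr => x _; rewrite mulr_sumr; apply: eq_bigr => u _.
by rewrite !mulr_sumr; apply: eq_bigr => a _; rewrite !mulrA.
Qed.

(** A start where the potential is below 1 leaves a positive probability of never
becoming bad. *)
Lemma never_bad_positive t c w b : I (pa_graph G0 c w b t) ->
  (0 < P (hist t c w b))%E -> L (pa_graph G0 c w b t) < 1 ->
  (0 < P (hist t c w b `&`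
          [set o | forall s, (t <= s)%N -> ~ bad (graph s o)]))%E.
Proof.
move=> IG H0 L1.
have mH := measurable_history t c w b.
pose E k := hist t c w b `&` bad_within k t.
have mE k : measurable (E k) by apply: measurableI (measurable_bad_within _ _).
have mU : measurable (\bigcup_k E k) by apply: bigcup_measurable.
have PU : (P (\bigcup_k E k) <= P (hist t c w b) * (L (pa_graph G0 c w b t))%:E)%E.
  have cv : (P \o E) x @[x --> \oo] --> P (\bigcup_k E k).
    apply: nondecreasing_cvg_mu => // k l kl; apply/subsetPset => o [ho [s st bo]].
    by split=> //; exists s => //; have := kl; move: st; lia.
  rewrite -(cvg_lim _ cv) //; apply: lime_le; first by apply/cvg_ex; eexists; exact: cv.
  by apply: nearW => k; apply: maximal_inequality_within.
rewrite (_ : _ `&` _ = hist t c w b `\` \bigcup_k E k).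
  rewrite measureD //; last first.
    by rewrite (le_lt_trans (probability_le1 _ _)) ?ltry.
  rewrite (_ : _ `&` _ = \bigcup_k E k); last first.
    by rewrite setIC; apply/setIidPl => o [k _ []].
  rewrite sube_gt0; apply: le_lt_trans PU _.
  by rewrite -[ltRHS]mule1 lte_pmul2l ?fin_num_measure // lte_fin.
apply/seteqP; split=> o [ho no]; split=> //.
  by move=> [k _ [_ [s /andP[ts _] bo]]]; apply: no bo.
move=> s ts bo; apply: no; exists s => //; split=> //; exists s => //.
by rewrite ts leq_addl.
Qed.

End MaximalInequality.
End Realization.

(** * Weak coupling between communities *)

Section Bounds.
Context {R : realType}.

Lemma uniform_pos (I : finType) (f : I -> R) : (forall i, 0 < f i) ->
  exists2 c : R, 0 < c & forall i, c <= f i.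
Proof.
move=> f0; have s0 : 0 <= \sum_i (f i)^-1 by apply: sumr_ge0 => i _; rewrite invr_ge0 ltW.
exists (1 + \sum_i (f i)^-1)^-1; first by rewrite invr_gt0 ltr_pwDl.
move=> i; rewrite -[leRHS]invrK lef_pV2 ?posrE ?invr_gt0 ?ltr_pwDl //.
rewrite (bigD1 i) //= addrCA lerDl addr_ge0 //.
by apply: sumr_ge0 => j _; rewrite invr_ge0 ltW.
Qed.

Lemma norm_sum_le (I : finType) (f : I -> R) (c : R) : (forall i, `|f i| <= c) ->
  `|\sum_i f i| <= #|I|%:R * c.
Proof.
move=> fc; apply: le_trans (ler_norm_sum _ _ _) _.
apply: (@le_trans _ _ (\sum_(i : I) c)); first by apply: ler_sum => i _.
by rewrite sumr_const mulr_natl.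
Qed.

Lemma norm_mul_le (x y a b : R) : `|x| <= a -> `|y| <= b -> `|x * y| <= a * b.
Proof. by move=> xa yb; rewrite normrM ler_pM. Qed.

Lemma dist_le (x y z a b c : R) : `|x - y| <= a -> `|y - z| <= b -> a + b <= c ->
  `|x - z| <= c.
Proof. by move=> xy yz; apply: le_trans; apply: le_trans (ler_distD y _ _) (lerD xy yz). Qed.

Lemma poly_increment (Q : {poly R}) (z rho lo hi a b : R) : 0 < rho ->
  (forall y : R, `|y - z| <= rho -> lo <= Q^`().[y] <= hi) ->
  `|a - z| <= rho -> `|b - z| <= rho ->
  exists2 s : R, lo <= s <= hi & Q.[a] - Q.[b] = s * (a - b).
Proof.
move=> rho0 Qd az bz.
wlog ab : a b az bz / a <= b => [hw|].
  have [ab|/ltW ba] := leP a b; first exact: hw.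
  by have [s sb e] := hw b a bz az ba; exists s => //; rewrite -opprB e; ring.
move: ab; rewrite le_eqVlt => /orP[/eqP ->|ab].
  by exists (Q^`().[b]); [exact: Qd | rewrite !subrr mulr0].
have [y] := poly_mvt Q ab; rewrite in_itv /= => /andP[ay yb] e.
exists (Q^`().[y]); last by rewrite -opprB e; ring.
by apply: Qd; move: az bz; rewrite !ler_norml; lra.
Qed.

Lemma horner_near (Q : {poly R}) (z eps : R) : 0 < eps ->
  exists2 rho : R, 0 < rho & forall y : R, `|y - z| <= rho -> `|Q.[y] - Q.[z]| <= eps.
Proof.
move=> eps0; have := @continuous_horner R Q z.
move=> /cvgrPdist_le /(_ eps eps0) [] /= rho rho0 near.
exists (rho / 2); first by rewrite divr_gt0.
move=> y yz; rewrite distrC; apply: near => /=.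
by rewrite distrC (le_lt_trans yz) //; lra.
Qed.

End Bounds.

Section WeakCoupling.
Context {R : realType} {N : nat}.
Variables (A1 : 'M[R]_N) (mu : 'I_N -> R) (c : R).
Hypotheses (hA1 : attractiveness A1) (hdiag : forall i, 0 < A1 i i).
Hypotheses (hmu : community_law mu) (c_gt0 : 0 < c).

Definition in_band (X : 'I_N -> R) := forall i, c <= X i <= 2.

Lemma community_law_le1 i : mu i <= 1.
Proof.
case: hmu => mu0 <-; rewrite (bigD1 i) //= lerDl.
by apply: sumr_ge0 => j _; apply: ltW.
Qed.

Lemma interpolation_diag theta i : interpolation A1 theta i i = A1 i i.
Proof. by rewrite !mxE eqxx mulr1n; ring. Qed.

Lemma interpolation_off theta i j : i != j ->
  interpolation A1 theta i j = theta * A1 i j.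
Proof. by move=> /negbTE ij; rewrite !mxE ij mulr0n; ring. Qed.

Lemma interpolation_positive theta : 0 < theta ->
  positive_diagonal (interpolation A1 theta).
Proof.
move=> t0; case: hA1 => A0 _; split=> [x y|i]; last by rewrite interpolation_diag.
have [->|xy] := eqVneq x y; first by rewrite interpolation_diag.
by rewrite interpolation_off // mulr_ge0 // ltW.
Qed.

Lemma interpolation_gt0 theta x y : 0 < theta -> 0 < A1 x y ->
  0 < interpolation A1 theta x y.
Proof.
move=> t0 Axy; have [->|xy] := eqVneq x y; first by rewrite interpolation_diag.
by rewrite interpolation_off // mulr_gt0.
Qed.

(** Off the diagonal, A has the factor theta. The denominator of a share stays
bounded below uniformly in theta, because the diagonal of A does not depend on
theta and the masses are at least [c]. *)
Lemma share_off_diagonal : exists2 K : R, 0 < K &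
  forall theta : R, 0 < theta < 1 ->
  forall (X X' : 'I_N -> R) (e : R) u y, in_band X -> in_band X' ->
  (forall i, `|X i - X' i| <= e) -> u != y ->
  `|share (interpolation A1 theta) X u y| <= theta * K /\
  `|share (interpolation A1 theta) X u y - share (interpolation A1 theta) X' u y|
    <= theta * K * e.
Proof.
case: (hA1) => A0 _; have [a0 a0_gt0 a0_le] := uniform_pos hdiag.
pose a1 := 1 + \sum_x \sum_y A1 x y.
have sumA x : 0 <= \sum_y A1 x y by apply: sumr_ge0.
have a1_ge x y : A1 x y <= a1.
  rewrite /a1 (bigD1 x) //= (bigD1 y) //=.
  have h1 : 0 <= \sum_(j | j != y) A1 x j by apply: sumr_ge0.
  have h2 : 0 <= \sum_(i | i != x) \sum_j A1 i j by apply: sumr_ge0.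
  lra.
have a1_gt0 : 0 < a1 by rewrite ltr_pwDl //; apply: sumr_ge0.
pose s0 := a0 * c; have s0_gt0 : 0 < s0 by rewrite mulr_gt0.
have K1 : 0 < a1 * (2 / s0) by rewrite mulr_gt0 // divr_gt0.
have K2 : 0 <= a1 * (2 * (N%:R * a1) / (s0 * s0)).
  by rewrite mulr_ge0 ?divr_ge0 ?mulr_ge0 // ltW.
exists (a1 * (2 / s0) + a1 * (2 * (N%:R * a1) / (s0 * s0))); first lra.
move=> theta /andP[t0 t1] X X' e u y bX bX' Xe uy.
have e0 : 0 <= e by apply: le_trans (Xe u).
pose B := interpolation A1 theta.
have Bb v w : `|B v w| <= a1.
  rewrite /B; have [->|vw] := eqVneq v w.
    by rewrite interpolation_diag ger0_norm.
  rewrite interpolation_off // ger0_norm ?mulr_ge0 // ?(ltW t0) //.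
  by apply: le_trans (a1_ge v w); rewrite ler_piMl // ltW.
have X0 Y : in_band Y -> forall i, 0 < Y i.
  by move=> bY i; have /andP[cY _] := bY i; apply: lt_le_trans cY.
pose S (Y : 'I_N -> R) := \sum_w B w y * Y w.
have S_ge Y : in_band Y -> s0 <= S Y.
  move=> bY; rewrite /S (bigD1 y) //= /B interpolation_diag.
  have : 0 <= \sum_(i | i != y) B i y * Y i.
    apply: sumr_ge0 => i _; rewrite mulr_ge0 ?(ltW (X0 _ bY _)) //.
    by case: (interpolation_positive t0).
  rewrite -/B; have /andP[cY _] := bY y.
  have : s0 <= A1 y y * Y y by rewrite ler_pM // ltW.
  lra.
have S_diff : `|S X' - S X| <= N%:R * a1 * e.
  rewrite /S -sumrB -mulrA -[N in leRHS]card_ord; apply: norm_sum_le => w.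
  by rewrite -mulrBr; apply: norm_mul_le => //; rewrite distrC.
have inv_le Y : in_band Y -> `|(S Y)^-1| <= s0^-1.
  move=> bY; have sY := S_ge Y bY; have sY0 := lt_le_trans s0_gt0 sY.
  by rewrite ger0_norm ?invr_ge0 ?(ltW sY0) // lef_pV2 ?posrE.
have X2 Y v : in_band Y -> `|Y v| <= 2.
  by move=> bY; rewrite ger0_norm ?(ltW (X0 _ bY _)) //; case/andP: (bY v).
have A1n : `|A1 u y| <= a1 by rewrite ger0_norm.
have shareE Y : share B Y u y = theta * (A1 u y * (Y u * (S Y)^-1)).
  by rewrite /share /B interpolation_off //; rewrite !mulrA.
rewrite -/B !shareE -mulrBr -mulrBr !normrM (ger0_norm (ltW t0)); split.
  rewrite ler_pM2l // -!normrM.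
  apply: (@le_trans _ _ (a1 * (2 / s0))); last lra.
  by do 2?[apply: norm_mul_le => //]; [exact: X2 | exact: inv_le].
rewrite -mulrA ler_pM2l // -normrM.
have -> : (a1 * (2 / s0) + a1 * (2 * (N%:R * a1) / (s0 * s0))) * e =
   a1 * (2 / s0 * e + 2 * (N%:R * a1 * e) * (s0^-1 * s0^-1)).
  by rewrite -invfM; ring.
apply: norm_mul_le => //.
have SX : S X != 0 by rewrite gt_eqF // (lt_le_trans s0_gt0) // S_ge.
have SX' : S X' != 0 by rewrite gt_eqF // (lt_le_trans s0_gt0) // S_ge.
have -> : X u * (S X)^-1 - X' u * (S X')^-1 =
    (X u - X' u) * (S X)^-1 + X' u * (S X' - S X) * ((S X)^-1 * (S X')^-1).
  by field; rewrite SX SX'.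
apply: le_trans (ler_normD _ _) _; apply: lerD.
  apply: (@le_trans _ _ (e * s0^-1)); first exact: norm_mul_le (inv_le _ _).
  have : 0 <= e * s0^-1 by rewrite mulr_ge0 // invr_ge0 ltW.
  lra.
apply: norm_mul_le; first by apply: norm_mul_le => //; exact: X2.
by apply: norm_mul_le; exact: inv_le.
Qed.

(** Both differences are sums of off-diagonal terms only. For the inflow, the
shares received by the newcomers of one community add up to 1, so that
2 (inflow_i - mu_i) is the balance of what i gets from and loses to the other
communities. *)
Lemma weak_coupling : exists2 L : R, 0 < L &
  forall theta : R, 0 < theta < 1 -> forall (B := interpolation A1 theta) X X' Z Z' e i,
  in_band X -> in_band X' -> (forall j, `|Z j| <= 2) -> (forall j, `|Z' j| <= 2) ->
  (forall j, `|X j - X' j| <= e) -> (forall j, `|Z j - Z' j| <= e) ->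
  [/\ `|inflow B mu X i - mu i| <= theta * L,
      `|inflow B mu X i - inflow B mu X' i| <= theta * L * e,
      `|mixture B X Z i - Z i| <= theta * L &
      `|(mixture B X Z i - Z i) - (mixture B X' Z' i - Z' i)| <= theta * L * e].
Proof.
have [K K0 shareK] := share_off_diagonal.
have NK : 0 <= N%:R * K by rewrite mulr_ge0 // ltW.
exists (6 * (N%:R * K) + 1); first lra.
move=> theta th B X X' Z Z' e i bX bX' Z2 Z2' Xe Ze.
have /andP[t0 t1] := th.
have pB : positive_diagonal B by apply: interpolation_positive.
have e0 : 0 <= e by apply: le_trans (Xe i).
have X0 Y : in_band Y -> forall j, 0 < Y j.
  by move=> bY j; have /andP[cY _] := bY j; apply: lt_le_trans cY.
have tK : 0 <= theta * K by rewrite mulr_ge0 // ltW.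
have tKe : 0 <= theta * K * e by rewrite mulr_ge0.
have mu1 j : `|mu j| <= 1.
  by rewrite ger0_norm ?community_law_le1 // ltW //; case: hmu.
have inflowE Y : in_band Y -> inflow B mu Y i - mu i =
    (\sum_y (mu y * share B Y i y - mu i * share B Y y i)) / 2.
  move=> bY; rewrite sumrB -mulr_sumr share_total //; last exact: X0.
  by rewrite /inflow; field.
have mixE Y V : in_band Y -> mixture B Y V i - V i =
    \sum_u share B Y u i * (V u - V i).
  move=> bY; under [RHS]eq_bigr do rewrite mulrBr.
  by rewrite sumrB -mulr_suml share_total ?mul1r //; exact: X0.
have S1 u y : u != y -> `|share B X u y| <= theta * K.
  by move=> uy; have [] := shareK theta th X X' e u y bX bX' Xe uy.
have S2 u y : u != y -> `|share B X u y - share B X' u y| <= theta * K * e.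
  by move=> uy; have [] := shareK theta th X X' e u y bX bX' Xe uy.
split.
- rewrite inflowE // normrM.
  have : `|\sum_y (mu y * share B X i y - mu i * share B X y i)| <=
      N%:R * (2 * (theta * K)).
    rewrite -[N in leRHS]card_ord; apply: norm_sum_le => y.
    have [->|iy] := eqVneq i y; first by rewrite subrr normr0; lra.
    apply: le_trans (ler_normB _ _) _.
    have := norm_mul_le (mu1 y) (S1 _ _ iy).
    have yi : y != i by rewrite eq_sym.
    have := norm_mul_le (mu1 i) (S1 _ _ yi); lra.
  rewrite [`|2^-1|]ger0_norm ?invr_ge0 //.
  move: (`|_|) => a; have : 0 <= theta * (N%:R * K) by rewrite mulr_ge0 // ltW.
  lra.
- have -> : inflow B mu X i - inflow B mu X' i =
     (inflow B mu X i - mu i) - (inflow B mu X' i - mu i) by ring.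
  rewrite !inflowE // -mulrBl -sumrB normrM [`|2^-1|]ger0_norm ?invr_ge0 //.
  set s := \sum_y _.
  have : `|s| <= N%:R * (2 * (theta * K * e)).
    rewrite -[N in leRHS]card_ord; apply: norm_sum_le => y.
    have -> : mu y * share B X i y - mu i * share B X y i -
      (mu y * share B X' i y - mu i * share B X' y i) =
      mu y * (share B X i y - share B X' i y) -
      mu i * (share B X y i - share B X' y i) by ring.
    have [->|iy] := eqVneq i y; first by rewrite subrr normr0; lra.
    apply: le_trans (ler_normB _ _) _.
    have := norm_mul_le (mu1 y) (S2 _ _ iy).
    have yi : y != i by rewrite eq_sym.
    have := norm_mul_le (mu1 i) (S2 _ _ yi); lra.
  move: (`|_|) => a; have : 0 <= theta * (N%:R * K) * e by rewrite !mulr_ge0 // ltW.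
  have : 0 <= theta * e by rewrite mulr_ge0 // ltW.
  lra.
- rewrite mixE //; apply: (@le_trans _ _ (N%:R * (4 * (theta * K)))).
    rewrite -[N in leRHS]card_ord; apply: norm_sum_le => u.
    have [->|ui] := eqVneq u i; first by rewrite subrr mulr0 normr0; lra.
    rewrite mulrC; apply: norm_mul_le (S1 _ _ ui).
    by apply: le_trans (ler_normB _ _) _; have := Z2 u; have := Z2 i; lra.
  have : 0 <= theta * (N%:R * K) by rewrite mulr_ge0 // ltW.
  lra.
- rewrite !mixE // -sumrB; apply: (@le_trans _ _ (N%:R * (6 * (theta * K * e)))).
    rewrite -[N in leRHS]card_ord; apply: norm_sum_le => u.
    have [->|ui] := eqVneq u i; first by rewrite !subrr !mulr0 subrr normr0; lra.
    have -> : share B X u i * (Z u - Z i) - share B X' u i * (Z' u - Z' i) =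
      share B X u i * ((Z u - Z' u) - (Z i - Z' i)) +
      (share B X u i - share B X' u i) * (Z' u - Z' i) by ring.
    apply: le_trans (ler_normD _ _) _.
    have d1 : `|(Z u - Z' u) - (Z i - Z' i)| <= 2 * e.
      by apply: le_trans (ler_normB _ _) _; have := Ze u; have := Ze i; lra.
    have d2 : `|Z' u - Z' i| <= 4.
      by apply: le_trans (ler_normB _ _) _; have := Z2' u; have := Z2' i; lra.
    have := norm_mul_le (S1 _ _ ui) d1; have := norm_mul_le (S2 _ _ ui) d2; lra.
  have : 0 <= theta * (N%:R * K) * e by rewrite !mulr_ge0 // ltW.
  have : 0 <= theta * e by rewrite mulr_ge0 // ltW.
  lra.
Qed.

End WeakCoupling.

(** * Equilibrium and drift *)

Section Contraction.
Context {R : realType}.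

(** Row vectors are complete and normed; this joins the two structures. *)
HB.instance Definition _ (n : nat) := Complete.copy 'rV[R]_n 'rV[R]_n.

Lemma row_norm_coord n (v : 'rV[R]_n) k : `|v 0 k| <= `|v|.
Proof.
rewrite [`|v|]mx_normrE.
exact: (@le_bigmax _ _ _ 0 (fun ij : 'I_1 * 'I_n => `|v ij.1 ij.2|) (0, k)).
Qed.

Lemma row_norm_le n (v : 'rV[R]_n) (e : R) : 0 <= e -> (forall k, `|v 0 k| <= e) -> `|v| <= e.
Proof.
move=> e0 ve; rewrite [`|v|]mx_normrE; apply: bigmax_le => // -[i k] _ /=.
by rewrite (ord1 i).
Qed.

Lemma contraction_row n (f : 'rV[R]_n -> 'rV[R]_n) (ctr : 'rV[R]_n) (eta k : R) :
  0 < eta -> 0 <= k < 1 ->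
  (forall v, `|v - ctr| <= eta -> `|f v - ctr| <= eta) ->
  (forall v w, `|v - ctr| <= eta -> `|w - ctr| <= eta ->
     `|f v - f w| <= k * `|v - w|) ->
  exists2 v, `|v - ctr| <= eta & f v = v.
Proof.
move=> eta0 /andP[k0 k1] fU fk.
pose U := closed_ball ctr eta.
have UE v : U v <-> `|v - ctr| <= eta.
  by rewrite /U closed_ballE // /closed_ball_ /= distrC.
have fUU : {homo f : v / U v >-> U v} by move=> v /UE /fU /UE.
have [] := @banach_fixed_point R 'rV[R]_n U (mkfun_fun fUU).
- exists (NngNum k0); split=> //= -[v w] [/= Uv Uw].
  by apply: fk; apply/UE.
- exact: closed_ball_closed.
- by exists ctr; apply/UE; rewrite subrr normr0 ltW.
by move=> v /UE Uv e; exists v.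
Qed.

End Contraction.

Section CommunityDrift.
Context {R : realType}.

(** The contribution of one community to the drift. With x and y the deviations
of X and Z from the equilibrium, D the increment of the inflow and w that of the
coupling term, the damping terms are -x^2 and nu/2 (s - 1) X y^2, where s is a
slope of R, at most 1 - rho. The rest is cross terms of order t e^2, and the term
in (D - x) X y^2, which takes up at most half of the damping. *)
Lemma community_drift (rho lam t e nu X x y D w s : R) :
  0 < rho -> rho <= 1 -> 0 <= lam -> 0 <= t -> 0 <= e -> rho <= nu <= 1 -> 0 <= X <= 2 ->
  - lam <= s <= 1 - rho ->
  `|x| <= e -> `|y| <= e -> `|D| <= t * e -> `|w| <= t * e -> D - x <= rho ^+ 2 / 4 ->
  x * (D - x) + X * y * (nu / 2 * ((s - 1) * y + s * w) + (D - x) * y) <=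
  - (rho ^+ 2 / 8) * (x ^+ 2 + (X * y) ^+ 2) + (2 + lam) * (t * e ^+ 2).
Proof.
move=> rho0 rho1 lam0 t0 e0 /andP[nu0 nu1] /andP[X0 X2] /andP[s1 s2] xe ye De we Dx.
have xD : x * D <= t * e ^+ 2.
  apply: le_trans (ler_norm _) _.
  by rewrite (_ : t * e ^+ 2 = e * (t * e)); [exact: norm_mul_le | ring].
have cross : X * y * (nu / 2 * (s * w)) <= (1 + lam) * (t * e ^+ 2).
  apply: le_trans (ler_norm _) _.
  have -> : (1 + lam) * (t * e ^+ 2) = 2 * e * (2^-1 * ((1 + lam) * (t * e))) by field.
  clear Dx De xD; do ?[apply: norm_mul_le => //].
  - by rewrite ger0_norm.
  - by rewrite ger0_norm; lra.
  by rewrite ler_norml; apply/andP; split; lra.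
have y2 : 0 <= X * y ^+ 2 by rewrite mulr_ge0 // sqr_ge0.
have rho2 : 0 <= rho ^+ 2 <= 1 by rewrite sqr_ge0 exprn_ile1 // ltW.
have main : (nu / 2 * (s - 1) + (D - x)) * (X * y ^+ 2) <= - (rho ^+ 2 / 4) * (X * y ^+ 2).
  rewrite ler_wpM2r //.
  have : nu * rho <= nu * (1 - s) by rewrite ler_wpM2l; lra.
  have : rho * rho <= nu * rho by rewrite ler_wpM2r // ltW.
  by rewrite expr2 in Dx *; lra.
have rx : rho ^+ 2 / 8 * x ^+ 2 <= x ^+ 2 by rewrite ler_piMl ?sqr_ge0 //; lra.
have ry : rho ^+ 2 / 8 * (X * y) ^+ 2 <= rho ^+ 2 / 8 * (2 * (X * y ^+ 2)).
  rewrite ler_wpM2l //; first lra.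
  by rewrite exprMn expr2 -mulrA ler_wpM2r.
have -> : x * (D - x) + X * y * (nu / 2 * ((s - 1) * y + s * w) + (D - x) * y) =
  x * D - x ^+ 2 + (nu / 2 * (s - 1) + (D - x)) * (X * y ^+ 2) +
    X * y * (nu / 2 * (s * w)) by ring.
clear - xD cross main rx ry; lra.
Qed.

End CommunityDrift.

Section Equilibrium.
Context {R : realType} {N : nat}.
Variables (mu z : 'I_N -> R) (Q : {poly R}) (rho lam : R).
Hypotheses (rho_gt0 : 0 < rho) (lam_ge0 : 0 <= lam).
Hypothesis rho_mu : forall i, rho <= mu i.
Hypothesis mu_le1 : forall i, mu i <= 1.
Hypothesis z01 : forall i, 0 <= z i <= 1.
Hypothesis z_fix : forall i, Q.[z i] = z i.
Hypothesis dQ : forall i (y : R), `|y - z i| <= rho -> - lam <= Q^`().[y] <= 1 - rho.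
Variables (phi : ('I_N -> R) -> 'I_N -> R) (q : ('I_N -> R) -> ('I_N -> R) -> 'I_N -> R).
Variable t : R.
Hypothesis t_ge0 : 0 <= t.
Hypothesis weak : forall (X X' Z Z' : 'I_N -> R) (e : R) i,
  in_band (rho / 2) X -> in_band (rho / 2) X' ->
  (forall j, `|Z j| <= 2) -> (forall j, `|Z' j| <= 2) ->
  (forall j, `|X j - X' j| <= e) -> (forall j, `|Z j - Z' j| <= e) ->
  [/\ `|phi X i - mu i| <= t, `|phi X i - phi X' i| <= t * e,
      `|q X Z i - Z i| <= t &
      `|(q X Z i - Z i) - (q X' Z' i - Z' i)| <= t * e].

Definition near_target (r : R) (X Z : 'I_N -> R) :=
  forall i, `|X i - mu i| <= r /\ `|Z i - z i| <= r.

Lemma near_target_band (r : R) X Z : r <= rho / 2 -> near_target r X Z -> (0 < N)%N ->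
  in_band (rho / 2) X /\ (forall j, `|Z j| <= 2).
Proof.
move=> rr nt N0; have i0 : 'I_N by case: N N0 => // n _; exact: ord0.
have rho1 : rho <= 1 := le_trans (rho_mu i0) (mu_le1 i0).
have rho0 := rho_gt0; have lam0 := lam_ge0; have t0 := t_ge0.
split=> j; have [] := nt j; have := rho_mu j; have := mu_le1 j; have /andP[] := z01 j.
  by rewrite !ler_norml => z0 z1 h1 h2 /andP[a1 a2] _; apply/andP; split; lra.
by rewrite !ler_norml => z0 z1 h1 h2 _ /andP[a1 a2]; apply/andP; split; lra.
Qed.

Lemma reaction_difference i (a b : R) : `|a - z i| <= rho -> `|b - z i| <= rho ->
  exists2 s : R, - lam <= s <= 1 - rho & Q.[a] - Q.[b] = s * (a - b).
Proof. by move=> az bz; apply: poly_increment (dQ (i := i)) az bz. Qed.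

(** A slope of R may be far below -1, so R itself need not contract. The step
1 / (1 + lam), with -lam a lower bound for the slopes, keeps the multiplier of
Y - Y' between 0 and 1 - rho / (1 + lam). *)
Lemma relaxation_contracts i (a b Y Y' : R) : `|a - z i| <= rho -> `|b - z i| <= rho ->
  `|(Y + (Q.[a] - Y) / (1 + lam)) - (Y' + (Q.[b] - Y') / (1 + lam))| <=
  (1 - rho / (1 + lam)) * `|Y - Y'| + `|(a - Y) - (b - Y')|.
Proof.
move=> az bz; have [s /andP[s1 s2] e] := reaction_difference az bz.
have rho0 := rho_gt0; have lam0 := lam_ge0.
pose h := (1 + lam)^-1; have h0 : 0 < h by rewrite invr_gt0; lra.
have hl : h * (1 + lam) = 1 by rewrite mulVf // gt_eqF //; lra.
have -> : (Y + (Q.[a] - Y) / (1 + lam)) - (Y' + (Q.[b] - Y') / (1 + lam)) =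
   (1 + h * (s - 1)) * (Y - Y') + h * s * ((a - Y) - (b - Y')).
  transitivity (Y - Y' + h * ((Q.[a] - Q.[b]) - (Y - Y'))); first by rewrite /h; ring.
  by rewrite e; ring.
have hs1 : h * (- lam) <= h * s by rewrite ler_pM2l.
have hs2 : h * s <= h * (1 - rho) by rewrite ler_pM2l.
have rho1 : 0 <= h * rho by rewrite mulr_ge0 // ltW.
apply: le_trans (ler_normD _ _) _; rewrite !normrM -/h.
have c1 : `|1 + h * (s - 1)| <= 1 - rho * h by rewrite ger0_norm; lra.
have hlam : 0 <= h * lam by rewrite mulr_ge0 // ltW.
have c2 : `|h| * `|s| <= 1 by rewrite -normrM ler_norml; apply/andP; split; lra.
apply: lerD; first by rewrite ler_wpM2r.
by rewrite -[leRHS]mul1r ler_wpM2r.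
Qed.

(** The map (X, Z) -> (phi X, Z + (Q(q X Z) - Z) / (1 + lam)) is a contraction of
the ball of radius eta around (mu, z) when the coupling t is small: in X its
Lipschitz constant is t, in Z it is 1 - rho / (1 + lam) + t. *)
Lemma equilibrium_exists (eta : R) : (0 < N)%N -> 0 < eta -> eta <= rho / 2 -> eta <= 1 ->
  t <= eta / 2 -> 2 * (t * (1 + lam)) <= rho * eta ->
  exists Xs Zs : 'I_N -> R, [/\ near_target eta Xs Zs, forall i, phi Xs i = Xs i &
                    forall i, Q.[q Xs Zs i] = Zs i].
Proof.
move=> N0 eta0 eta_rho eta1 t_eta t_lam.
have i0 : 'I_N by case: N N0 => // n _; exact: ord0.
have rho1 : rho <= 1 := le_trans (rho_mu i0) (mu_le1 i0).
have rho0 := rho_gt0; have lam0 := lam_ge0; have t0 := t_ge0.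
pose h := (1 + lam)^-1; have h0 : 0 < h by rewrite invr_gt0; lra.
have hl : h * (1 + lam) = 1 by rewrite mulVf // gt_eqF //; lra.
have th : 2 * t <= h * rho * eta.
  have : h * (2 * (t * (1 + lam))) <= h * (rho * eta) by rewrite ler_pM2l.
  have -> : h * (2 * (t * (1 + lam))) = 2 * t * (h * (1 + lam)) by ring.
  by rewrite hl; lra.
have h1 : h <= 1 by rewrite invf_le1; lra.
have hr0 : 0 < h * rho by rewrite mulr_gt0.
have hr1 : h * rho <= 1 by rewrite -[leRHS]mul1r ler_pM // ltW.
have hre : h * rho * eta <= h * rho by rewrite ler_piMr // ltW.
have t_rho : t + eta <= rho by lra.
pose XofV (v : 'rV[R]_(N + N)) (i : 'I_N) : R := v 0 (lshift N i).
pose ZofV (v : 'rV[R]_(N + N)) (i : 'I_N) : R := v 0 (rshift N i).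
(* The pair (X, Z) is encoded as one row vector; its norm is the maximum norm. *)
pose ctr : 'rV[R]_(N + N) := row_mx (\row_i mu i) (\row_i z i).
pose f (v : 'rV[R]_(N + N)) : 'rV[R]_(N + N) := row_mx (\row_i phi (XofV v) i)
  (\row_i (ZofV v i + (Q.[q (XofV v) (ZofV v) i] - ZofV v i) / (1 + lam))).
have XB (v w : 'rV[R]_(N + N)) i : XofV (v - w) i = XofV v i - XofV w i by rewrite /XofV !mxE.
have ZB (v w : 'rV[R]_(N + N)) i : ZofV (v - w) i = ZofV v i - ZofV w i by rewrite /ZofV !mxE.
have Xc i : XofV ctr i = mu i by rewrite /XofV row_mxEl mxE.
have Zc i : ZofV ctr i = z i by rewrite /ZofV row_mxEr mxE.
have near (v : 'rV[R]_(N + N)) : `|v - ctr| <= eta -> near_target eta (XofV v) (ZofV v).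
  move=> vc i; split.
    have := le_trans (row_norm_coord (v - ctr) (lshift N i)) vc.
    by rewrite -/(XofV _ i) XB Xc.
  have := le_trans (row_norm_coord (v - ctr) (rshift N i)) vc.
  by rewrite -/(ZofV _ i) ZB Zc.
have coords v (e : R) : 0 <= e -> (forall i, `|XofV v i| <= e) ->
    (forall i, `|ZofV v i| <= e) -> `|v| <= e.
  move=> e0 Xe Ze; apply: row_norm_le => // k.
  by rewrite -(fintype.splitK k); case: (fintype.split k) => j /=; [exact: Xe | exact: Ze].
have fX v i : XofV (f v) i = phi (XofV v) i by rewrite /XofV row_mxEl mxE.
have fZ v i : ZofV (f v) i =
   ZofV v i + (Q.[q (XofV v) (ZofV v) i] - ZofV v i) / (1 + lam).
  by rewrite /ZofV row_mxEr mxE.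
have zz i : `|z i - z i| <= rho by rewrite subrr normr0 ltW.
have q_near v i : `|v - ctr| <= eta -> `|q (XofV v) (ZofV v) i - z i| <= rho.
  move=> vc; have [bX bZ] := near_target_band eta_rho (near v vc) N0.
  have sub0 (Y : 'I_N -> R) j : `|Y j - Y j| <= 0 by rewrite subrr normr0.
  have [_ _ h2 _] := weak i bX bX bZ bZ (sub0 _) (sub0 _).
  exact: dist_le h2 (near v vc i).2 t_rho.
have [|||v vc fv] := @contraction_row R (N + N) f ctr eta (1 - h * rho / 2) eta0.
- by apply/andP; split; lra.
- move=> v vc; have [bX bZ] := near_target_band eta_rho (near v vc) N0.
  have sub0 (Y : 'I_N -> R) j : `|Y j - Y j| <= 0 by rewrite subrr normr0.
  apply: coords => [|i|i]; first exact: ltW.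
    rewrite XB fX Xc.
    by have [h2 _ _ _] := weak i bX bX bZ bZ (sub0 _) (sub0 _); lra.
  rewrite ZB fZ Zc; have [_ _ h2 _] := weak i bX bX bZ bZ (sub0 _) (sub0 _).
  have := relaxation_contracts (ZofV v i) (z i) (q_near v i vc) (zz i).
  rewrite z_fix subrr mul0r addr0 subr0 => h3; apply: le_trans h3 _.
  have [_ h4] := near v vc i; rewrite -/h.
  have : (1 - rho * h) * `|ZofV v i - z i| <= (1 - rho * h) * eta.
    by rewrite ler_wpM2l //; lra.
  by move: h2; lra.
- move=> v w vc wc.
  have [bX bZ] := near_target_band eta_rho (near v vc) N0.
  have [bX' bZ'] := near_target_band eta_rho (near w wc) N0.
  set e := `|v - w|; have e0 : 0 <= e by apply: normr_ge0.
  have Xe j : `|XofV v j - XofV w j| <= e by rewrite -XB row_norm_coord.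
  have Ze j : `|ZofV v j - ZofV w j| <= e by rewrite -ZB row_norm_coord.
  have te : t * e <= h * rho / 2 * e by rewrite ler_wpM2r //; lra.
  apply: coords => [|i|i]; first by rewrite mulr_ge0 //; lra.
    rewrite XB !fX; have [_ h2 _ _] := weak i bX bX' bZ bZ' Xe Ze.
    apply: le_trans h2 _; apply: le_trans te _; rewrite ler_wpM2r //; lra.
  rewrite ZB !fZ; have [_ _ _ h2] := weak i bX bX' bZ bZ' Xe Ze.
  have h3 := relaxation_contracts (ZofV v i) (ZofV w i) (q_near v i vc) (q_near w i wc).
  apply: le_trans h3 _; rewrite -/h.
  have : (1 - rho * h) * `|ZofV v i - ZofV w i| <= (1 - rho * h) * e.
    by rewrite ler_wpM2l //; lra.
  by move: h2 te; lra.
exists (XofV v), (ZofV v); split=> [|i|i]; first exact: near.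
  by rewrite -{2}fv fX.
have := fZ v i; rewrite fv => /eqP; rewrite -subr_eq0 opprD addrA subrr add0r oppr_eq0.
rewrite mulf_eq0 invr_eq0 [1 + _ == 0]gt_eqF ?orbF; last lra.
by rewrite subr_eq0 => /eqP.
Qed.

(** The second deviation is weighted by X, because X_i (Z_i - Zs_i) is, like X_i,
a linear combination of edge counts divided by 2mn: one step moves it exactly by
(increment - value) / (n + 1), without a random denominator. *)
Definition lyapunov (Xs Zs X Z : 'I_N -> R) : R :=
  \sum_i ((X i - Xs i) ^+ 2 + (X i * (Z i - Zs i)) ^+ 2).

Lemma lyapunov_ge0 Xs Zs X Z : 0 <= lyapunov Xs Zs X Z.
Proof. by apply: sumr_ge0 => i _; rewrite addr_ge0 // sqr_ge0. Qed.

Lemma lyapunov_coord Xs Zs X Z i :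
  (X i - Xs i) ^+ 2 <= lyapunov Xs Zs X Z /\
  (X i * (Z i - Zs i)) ^+ 2 <= lyapunov Xs Zs X Z.
Proof.
rewrite /lyapunov (bigD1 i) //=; set s := \sum_(_ | _) _.
have s0 : 0 <= s by apply: sumr_ge0 => j _; rewrite addr_ge0 // sqr_ge0.
have := sqr_ge0 (X i - Xs i); have := sqr_ge0 (X i * (Z i - Zs i)).
by split; lra.
Qed.

Lemma norm_le_sqrt (x v : R) : x ^+ 2 <= v -> `|x| <= Num.sqrt v.
Proof. by move=> xv; rewrite -sqrtr_sqr ler_sqrt // (le_trans _ xv) ?sqr_ge0. Qed.

(** The summands are the mean velocities of X_i and of X_i (Z_i - Zs_i), each
multiplied by its deviation. *)
Lemma drift_negative Xs Zs X Z : (0 < N)%N ->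
  (forall i, phi Xs i = Xs i) -> (forall i, Q.[q Xs Zs i] = Zs i) ->
  near_target (rho / 4) Xs Zs -> near_target (rho ^+ 2 / 8) X Z ->
  t <= rho ^+ 2 / 8 ->
  N%:R * (2 + lam) * (rho / 2) ^- 2 * t <= rho ^+ 2 / 16 ->
  \sum_i ((X i - Xs i) * (phi X i - X i) +
    X i * (Z i - Zs i) *
    (mu i / 2 * (Q.[q X Z i] - Z i) + (phi X i - X i) * (Z i - Zs i))) <=
  - (rho ^+ 2 / 16) * lyapunov Xs Zs X Z.
Proof.
move=> N0 phis qs nXs nX tr tN.
have i0 : 'I_N by case: N N0 => // n _; exact: ord0.
have rho1 : rho <= 1 := le_trans (rho_mu i0) (mu_le1 i0).
have rho0 := rho_gt0; have lam0 := lam_ge0; have t0 := t_ge0.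
have rho2 : rho ^+ 2 <= rho by rewrite expr2 ler_piMr // ltW.
have rho2_gt0 : 0 < rho ^+ 2 by rewrite exprn_gt0.
have tr1 : t + rho ^+ 2 / 8 <= rho by lra.
have tr2 : t + rho / 4 <= rho by lra.
have tr3 : t + rho ^+ 2 / 8 <= rho ^+ 2 / 4 by lra.
have [bX bZ] : in_band (rho / 2) X /\ (forall j, `|Z j| <= 2).
  by apply: near_target_band nX N0; lra.
have [bXs bZs] : in_band (rho / 2) Xs /\ (forall j, `|Zs j| <= 2).
  by apply: near_target_band nXs N0; lra.
pose V := lyapunov Xs Zs X Z; have V0 : 0 <= V := lyapunov_ge0 Xs Zs X Z.
(* A common bound for all deviations, using X_i >= rho / 2. *)
pose e := (rho / 2)^-1 * Num.sqrt V.
have k1 : 1 <= (rho / 2)^-1 by rewrite invf_ge1; lra.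
have sV0 : 0 <= Num.sqrt V := sqrtr_ge0 V.
have e0 : 0 <= e by rewrite mulr_ge0 //; lra.
have e2 : e ^+ 2 = (rho / 2) ^- 2 * V by rewrite exprMn sqr_sqrtr // exprVn.
have Xe j : `|X j - Xs j| <= e.
  have [h1 _] := lyapunov_coord Xs Zs X Z j.
  by apply: le_trans (norm_le_sqrt h1) _; rewrite -[leLHS]mul1r ler_wpM2r.
have Ze j : `|Z j - Zs j| <= e.
  have [_ h1] := lyapunov_coord Xs Zs X Z j.
  have /andP[Xj _] := bX j; have rho_half : 0 < rho / 2 by lra.
  rewrite /e ler_pdivlMl //; apply: le_trans (norm_le_sqrt h1).
  rewrite normrM ler_wpM2r // ger0_norm //; lra.
apply: (@le_trans _ _ (\sum_i (- (rho ^+ 2 / 8) *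
   ((X i - Xs i) ^+ 2 + (X i * (Z i - Zs i)) ^+ 2) + (2 + lam) * (t * e ^+ 2)))).
  apply: ler_sum => i _; have /andP[X1 X2] := bX i.
  have [h1 h2 h3 h4] := weak i bX bXs bZ bZs Xe Ze.
  have [nXi nZi] := nX i; have [_ nZsi] := nXs i.
  have qz : `|q X Z i - z i| <= rho := dist_le h3 nZi tr1.
  have qsz : `|q Xs Zs i - z i| <= rho.
    have sub0 (Y : 'I_N -> R) j : `|Y j - Y j| <= 0 by rewrite subrr normr0.
    have [_ _ h5 _] := weak i bXs bXs bZs bZs (sub0 _) (sub0 _).
    exact: dist_le h5 nZsi tr2.
  have [s /andP[s1 s2] es] := reaction_difference qz qsz.
  rewrite qs in es.
  have -> : Q.[q X Z i] - Z i = (s - 1) * (Z i - Zs i) +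
      s * ((q X Z i - Z i) - (q Xs Zs i - Zs i)).
    have -> : Q.[q X Z i] = Zs i + s * (q X Z i - q Xs Zs i) by rewrite -es; ring.
    ring.
  have -> : phi X i - X i = (phi X i - phi Xs i) - (X i - Xs i) by rewrite phis; ring.
  have Dx : (phi X i - phi Xs i) - (X i - Xs i) <= rho ^+ 2 / 4.
    rewrite phis (_ : _ - _ - _ = phi X i - X i); last by ring.
    by apply: le_trans (ler_norm _) _; apply: dist_le h1 _ tr3; rewrite distrC.
  have X0 : 0 <= X i <= 2 by rewrite X2 (le_trans _ X1) // divr_ge0 // ltW.
  have nu01 : rho <= mu i <= 1 by rewrite rho_mu mu_le1.
  have s12 : - lam <= s <= 1 - rho by rewrite s1.
  exact: community_drift (Xe i) (Ze i) h2 h4 Dx.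
rewrite big_split /= -mulr_sumr -/(lyapunov Xs Zs X Z) -/V sumr_const card_ord.
rewrite -[_ *+ N]mulr_natl e2.
have : N%:R * (2 + lam) * (rho / 2) ^- 2 * t * V <= rho ^+ 2 / 16 * V by rewrite ler_wpM2r.
lra.
Qed.

End Equilibrium.

(** * One-step decrease of the energy *)

Lemma rule_polyE (R : realType) m (p : 'I_m.+1 -> R) y : (rule_poly p).[y] =
  \sum_(k < m.+1) 'C(m, k)%:R * (y ^+ k * (1 - y) ^+ (m - k)) * p k.
Proof.
rewrite /rule_poly horner_sum; apply: eq_bigr => k _.
rewrite hornerZ hornerM hornerXn horner_exp hornerD hornerN hornerX.
by rewrite -polyC1 hornerC; ring.
Qed.

Section StepMeanTheory.
Context {R : realType} {N m : nat}.
Variables (mu : 'I_N -> R) (A : 'M[R]_N) (p : 'I_m.+1 -> R).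
Hypotheses (hmu : community_law mu) (hp : type_rule p) (pA : positive_diagonal A).
Variable G : cgraph N.
Hypothesis prG : proper m G.
Implicit Types F H : cgraph N -> R.

Local Notation mean := (step_mean mu A p G).
Local Notation n := (nvertices G).

Lemma type_chance_ge0 (w : seq nat) b : 0 <= type_chance p G w b.
Proof. by have := hp (inord (count (red G) w)); rewrite /type_chance /red_chance; case: b; lra. Qed.

Lemma type_chance_total (w : seq nat) : \sum_b type_chance p G w b = 1.
Proof. by rewrite big_bool /=; ring. Qed.

Lemma step_mean_le F H :
  (forall x (u : {ffun 'I_m -> 'I_n}) b,
     F (add_vertex G x (neighbours u) b) <= H (add_vertex G x (neighbours u) b)) ->
  mean F <= mean H.
Proof.
move=> FH; have [mu0 _] := hmu; apply: ler_sum => x _; rewrite ler_wpM2l ?(ltW (mu0 _)) //.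
apply: ler_sum => u _; rewrite ler_wpM2l ?prodr_ge0 // => [j _|].
  exact: attach_prob_ge0.
by apply: ler_sum => b _; rewrite ler_wpM2l ?type_chance_ge0.
Qed.

Lemma step_mean_eq F H :
  (forall x (u : {ffun 'I_m -> 'I_n}) b,
     F (add_vertex G x (neighbours u) b) = H (add_vertex G x (neighbours u) b)) ->
  mean F = mean H.
Proof. by move=> FH; apply/eqP; rewrite eq_le !step_mean_le // => x u b; rewrite FH. Qed.

Lemma step_meanD F H : mean (fun G' => F G' + H G') = mean F + mean H.
Proof.
rewrite /step_mean -big_split; apply: eq_bigr => x _ /=; rewrite -mulrDr -big_split /=.
congr (_ * _); apply: eq_bigr => u _; rewrite -mulrDr -big_split /=.
by congr (_ * _); apply: eq_bigr => b _; rewrite mulrDr.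
Qed.

Lemma step_meanZ c F : mean (fun G' => c * F G') = c * mean F.
Proof.
rewrite /step_mean mulr_sumr; apply: eq_bigr => x _.
rewrite mulrCA; congr (_ * _); rewrite mulr_sumr; apply: eq_bigr => u _.
rewrite mulrCA; congr (_ * _); rewrite mulr_sumr; apply: eq_bigr => b _.
by rewrite mulrCA.
Qed.

Lemma step_mean_sum (I : Type) (r : seq I) (F : I -> cgraph N -> R) :
  mean (fun G' => \sum_(i <- r) F i G') = \sum_(i <- r) mean (F i).
Proof.
elim: r => [|i r IHr].
  rewrite big_nil -[RHS](mul0r (mean (fun=> 0))) -step_meanZ.
  by apply: step_mean_eq => x u b; rewrite big_nil mul0r.
by rewrite big_cons -IHr -step_meanD; apply: step_mean_eq => x u b; rewrite big_cons.
Qed.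

Lemma sum_neighbours k (u : {ffun 'I_m -> 'I_k}) (f : nat -> nat) :
  (\sum_(v <- neighbours u) f v = \sum_j f (u j))%N.
Proof. by rewrite big_tuple; apply: eq_bigr => j _; rewrite tnth_mktuple. Qed.

(** The number of red neighbours is binomial with the parameter [mixture], and
the mean of p over a binomial variable is the polynomial of the rule. *)
Lemma red_chance_mean x :
  \sum_(u : {ffun 'I_m -> 'I_n}) (\prod_j attach_prob A G x (u j)) *
    red_chance p G (neighbours u) =
  (rule_poly p).[mixture A (weight G) (red_proportion R G) x].
Proof.
rewrite -(attach_sum_red _ _ prG).
have count_red (u : {ffun 'I_m -> 'I_n}) :
    count (red G) (neighbours u) = (\sum_j red G (u j))%N.
  by rewrite -sum1_count big_mkcond /= -(sum_neighbours u (fun v => red G v)).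
rewrite (eq_bigr (fun u : {ffun 'I_m -> 'I_n} => (\prod_j attach_prob A G x (u j)) *
   p (inord (\sum_j red G (u j))))); last first.
  by move=> u _; rewrite /red_chance count_red.
rewrite (sample_count m (attach_total _ pA prG) (fun v : 'I_n => red G v)
  (fun k => p (inord k))).
by rewrite rule_polyE; apply: eq_bigr => k _; rewrite inord_val.
Qed.

Lemma neighbours_total x :
  \sum_(u : {ffun 'I_m -> 'I_n}) \prod_j attach_prob A G x (u j) = 1.
Proof. exact: sample_total m (attach_total x pA prG). Qed.

Lemma step_mean_const c : mean (fun=> c) = c.
Proof.
have [_ mu1] := hmu; rewrite /step_mean.
rewrite (eq_bigr (fun x => mu x * c)) => [|x _].
  by rewrite -mulr_suml mu1 mul1r.
congr (_ * _).
rewrite (eq_bigr (fun u : {ffun 'I_m -> 'I_n} => (\prod_j attach_prob A G x (u j)) * c)).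
  by rewrite -mulr_suml neighbours_total mul1r.
by move=> u _; rewrite -mulr_suml type_chance_total mul1r.
Qed.

Lemma step_mean_weight i :
  mean (weight ^~ i) = weight G i + (2 * m)%:R * inflow A mu (weight G) i.
Proof.
have [_ mu1] := hmu.
transitivity (\sum_x mu x * (weight G i + m%:R * (x == i)%:R +
   m%:R * share A (weight G) i x)).
  apply: eq_bigr => x _; congr (_ * _).
  transitivity (\sum_(u : {ffun 'I_m -> 'I_n}) ((\prod_j attach_prob A G x (u j)) *
     (weight G i + m%:R * (x == i)%:R) +
     (\prod_j attach_prob A G x (u j)) * \sum_j (comm G (u j) == i)%:R)).
    apply: eq_bigr => u _; rewrite -mulrDr; congr (_ * _).
    transitivity (\sum_b type_chance p G (neighbours u) b *
      (weight G i + m%:R * (x == i)%:R + \sum_j (comm G (u j) == i)%:R)).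
      apply: eq_bigr => b _; congr (_ * _); rewrite /weight comm_degree_add //; last first.
        by move=> v; apply: neighbours_lt.
      by rewrite sum_neighbours !natrD natrM natr_sum.
    by rewrite -mulr_suml type_chance_total mul1r.
  rewrite big_split /= -mulr_suml neighbours_total mul1r.
  rewrite (sample_mean m (attach_total _ pA prG) (fun v : 'I_n => (comm G v == i)%:R)).
  rewrite -(attach_sum_comm A G x i) [in RHS]big_mkcond /=; congr (_ + _ * _).
  by apply: eq_bigr => v _; case: eqP; rewrite ?mulr1 ?mulr0.
under eq_bigr do rewrite !mulrDr.
rewrite !big_split /= -mulr_suml mu1 mul1r -addrA; congr (_ + _).
rewrite (bigD1 i) //= eqxx big1 => [|x /negbTE ->]; last by rewrite !mulr0.
rewrite (eq_bigr (fun y => m%:R * (mu y * share A (weight G) i y))); last first.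
  by move=> y _; ring.
by rewrite -mulr_sumr /inflow natrM (_ : true%:R = 1 :> R) //; field.
Qed.

(** Community i gains red edge-ends from newcomers of i that become red, and from
edges received, of which the proportion Z_i goes to red vertices. The number of
edges received is 2 m inflow_i less the m mu_i edge-ends of the newcomers. *)
Lemma step_mean_red i : mean (fun G' => (red_degree G' i)%:R) =
  (red_degree G i)%:R +
  m%:R * (mu i * (rule_poly p).[mixture A (weight G) (red_proportion R G) i] +
          (2 * inflow A mu (weight G) i - mu i) * red_proportion R G i).
Proof.
have [_ mu1] := hmu.
pose Q x := (rule_poly p).[mixture A (weight G) (red_proportion R G) x].
transitivity (\sum_x mu x * ((red_degree G i)%:R + m%:R * (x == i)%:R * Q x +
   m%:R * (share A (weight G) i x * red_proportion R G i))).
  apply: eq_bigr => x _; congr (_ * _).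
  transitivity (\sum_(u : {ffun 'I_m -> 'I_n}) ((\prod_j attach_prob A G x (u j)) *
     (red_degree G i)%:R + m%:R * (x == i)%:R *
       ((\prod_j attach_prob A G x (u j)) * red_chance p G (neighbours u)) +
     (\prod_j attach_prob A G x (u j)) *
       \sum_j (red G (u j) && (comm G (u j) == i))%:R)).
    apply: eq_bigr => u _.
    have dE b : (red_degree (add_vertex G x (neighbours u) b) i)%:R =
       (red_degree G i)%:R + m%:R * (b && (x == i))%:R +
       \sum_j (red G (u j) && (comm G (u j) == i))%:R :> R.
      rewrite red_degree_add //; last by move=> v; apply: neighbours_lt.
      by rewrite (sum_neighbours u (fun v => red G v && (comm G v == i))) !natrD natrM natr_sum.
    rewrite big_bool /= !dE /= ; set s := \sum_j _.
    by ring.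
  rewrite !big_split /= -mulr_suml neighbours_total mul1r.
  rewrite -mulr_sumr red_chance_mean -/(Q x).
  rewrite (sample_mean m (attach_total _ pA prG)
    (fun v : 'I_n => (red G v && (comm G v == i))%:R)).
  rewrite -(attach_sum_red_comm _ _ _ prG) [in RHS]big_mkcond /=; congr (_ + _ * _).
  by apply: eq_bigr => v _; case: (_ && _); rewrite ?mulr1 ?mulr0.
under eq_bigr do rewrite !mulrDr.
rewrite !big_split /= -mulr_suml mu1 mul1r -addrA; congr (_ + _).
rewrite (bigD1 i) //= eqxx big1 => [|x /negbTE ->]; last by rewrite !(mulr0, mul0r).
rewrite (eq_bigr (fun y => m%:R * red_proportion R G i * (mu y * share A (weight G) i y)));
  last by move=> y _; ring.
by rewrite -mulr_sumr -/(Q i) /inflow (_ : true%:R = 1 :> R) //; field.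
Qed.

End StepMeanTheory.

Section LyapunovStep.
Context {R : realType} {N m : nat}.
Variables (mu : 'I_N -> R) (A : 'M[R]_N) (p : 'I_m.+1 -> R).
Hypotheses (hmu : community_law mu) (hp : type_rule p) (pA : positive_diagonal A).
Hypothesis m_gt0 : (0 < m)%N.
Implicit Types (G : cgraph N) (Xs Zs X Z : 'I_N -> R).

Definition total_degree (G : cgraph N) : R := (2 * m * nvertices G)%:R.

Definition degree_share (G : cgraph N) (i : 'I_N) : R := weight G i / total_degree G.

Definition energy (Xs Zs : 'I_N -> R) (G : cgraph N) : R :=
  lyapunov Xs Zs (degree_share G) (red_proportion R G).

Definition drift (Xs Zs X Z : 'I_N -> R) : R :=
  \sum_i ((X i - Xs i) * (inflow A mu X i - X i) +
    X i * (Z i - Zs i) *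
    (mu i / 2 * ((rule_poly p).[mixture A X Z i] - Z i) +
     (inflow A mu X i - X i) * (Z i - Zs i))).

Lemma total_degree_gt0 G (i : 'I_N) : proper m G -> 0 < total_degree G.
Proof. by move=> /(proper_nvertices_gt0 i) n0; rewrite ltr0n !muln_gt0 m_gt0 n0. Qed.

Lemma red_proportion01 G i : 0 <= red_proportion R G i <= 1.
Proof.
rewrite red_proportionE; apply/andP; split; first by rewrite divr_ge0 ?ler0n.
have [->|w0] := eqVneq (weight G i) (0 : R); first by rewrite invr0 mulr0.
by rewrite ler_pdivrMr ?mul1r ?ler_nat ?red_degree_le // lt0r w0 /weight ler0n.
Qed.

Lemma degree_share01 G i : proper m G -> 0 < degree_share G i <= 1.
Proof.
move=> pr; have s0 := total_degree_gt0 i pr.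
rewrite divr_gt0 ?(weight_gt0 _ pr) //= ler_pdivrMr // mul1r ler_nat.
by rewrite -(comm_degree_total pr) (bigD1 i) //= leq_addr.
Qed.

Lemma degree_share_red G i : proper m G ->
  degree_share G i * red_proportion R G i = (red_degree G i)%:R / total_degree G.
Proof. by move=> pr; rewrite (red_degree_proportion _ pr) /degree_share; ring. Qed.

Lemma inflow_share G i : proper m G ->
  inflow A mu (degree_share G) i = inflow A mu (weight G) i.
Proof.
move=> pr; congr ((_ + _) / _); apply: eq_bigr => y _.
by rewrite /degree_share share_scale // gt_eqF // (total_degree_gt0 i pr).
Qed.

Lemma mixture_share G Z i : proper m G ->
  mixture A (degree_share G) Z i = mixture A (weight G) Z i.
Proof.
move=> pr; apply: eq_bigr => y _.
by rewrite /degree_share share_scale // gt_eqF // (total_degree_gt0 i pr).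
Qed.

Lemma sqr_le_of_norm (x c : R) : `|x| <= c -> x ^+ 2 <= c ^+ 2.
Proof. by move=> xc; rewrite -real_normK ?num_real // lerXn2r // ?nnegrE // (le_trans _ xc). Qed.

(** Each coordinate of the energy moves by (increment - value) / (n + 1), with
increment and value bounded. The square expands into the old value, twice the
deviation times the movement, whose mean is the drift, and a term of order
1 / (n + 1)^2. *)
Lemma energy_step Xs Zs G : proper m G -> (forall i, `|Zs i| <= 2) ->
  step_mean mu A p G (energy Xs Zs) <=
  energy Xs Zs G +
  2 / (nvertices G).+1%:R * drift Xs Zs (degree_share G) (red_proportion R G) +
  37 * N%:R / (nvertices G).+1%:R ^+ 2.
Proof.
move=> pr Zs2; set n := nvertices G.
set X := degree_share G; set Z := red_proportion R G.
pose s : R := (2 * m)%:R.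
have s0 : 0 < s by rewrite ltr0n muln_gt0.
have k0 : 0 < n.+1%:R :> R by rewrite ltr0n.
pose a G' i := (weight G' i - weight G i) / s.
pose b G' i := ((red_degree G' i)%:R - (red_degree G i)%:R) / s - Zs i * a G' i.
(* The random counterpart of [drift]. *)
pose gain G' := \sum_i ((X i - Xs i) * (a G' i - X i) +
   X i * (Z i - Zs i) * (b G' i - X i * (Z i - Zs i))).
have pointwise x (u : {ffun 'I_m -> 'I_n}) c :
    energy Xs Zs (add_vertex G x (neighbours u) c) <=
    energy Xs Zs G + 2 / n.+1%:R * gain (add_vertex G x (neighbours u) c) +
    37 * N%:R / n.+1%:R ^+ 2.
  set G' := add_vertex _ _ _ _.
  have u_lt v : v \in neighbours u -> (v < nvertices G)%N by apply: neighbours_lt.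
  have pr' : proper m G' by apply: add_vertex_proper.
  rewrite /energy /lyapunov /gain mulr_sumr -big_split /=.
  (* 37 = 1 ^ 2 + 6 ^ 2 bounds the two squared movements of a community. *)
  have -> : 37 * N%:R / n.+1%:R ^+ 2 = \sum_(i < N) (37 / n.+1%:R ^+ 2 : R).
    by rewrite sumr_const card_ord -mulr_natr; ring.
  rewrite -big_split /=; apply: ler_sum => i _.
  have n0 : 0 < n%:R :> R by rewrite ltr0n (proper_nvertices_gt0 i pr).
  have tot : total_degree G = s * n%:R by rewrite /total_degree natrM.
  have tot' : total_degree G' = s * n.+1%:R by rewrite /total_degree natrM.
  have nS : n.+1%:R = n%:R + 1 :> R by rewrite -natr1.
  have le_s : (\sum_(v <- neighbours u) (comm G v == i) <= m)%N.
    rewrite sum_neighbours; apply: (@leq_trans (\sum_(j < m) 1)).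
      by apply: leq_sum => j _; case: (_ == _).
    by rewrite sum_nat_const card_ord muln1.
  have a01 : 0 <= a G' i <= 1.
    rewrite /a /weight comm_degree_add // -addnA natrD addrAC subrr add0r.
    rewrite divr_ge0 ?ler0n ?(ltW s0) //= ler_pdivrMr // mul1r ler_nat.
    rewrite mul2n -addnn; apply: leq_add le_s.
    by case: (x == i); rewrite ?muln1 ?muln0.
  have r01 : 0 <= ((red_degree G' i)%:R - (red_degree G i)%:R) / s <= 1.
    rewrite red_degree_add // -addnA natrD addrAC subrr add0r.
    rewrite divr_ge0 ?ler0n ?(ltW s0) //= ler_pdivrMr // mul1r ler_nat.
    rewrite mul2n -addnn; apply: leq_add; first by case: (c && _); rewrite ?muln1 ?muln0.
    by apply: leq_trans le_s; apply: leq_sum => v _; case: (red G v).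
  have X01 := degree_share01 i pr; have Z01 := red_proportion01 G i.
  rewrite -/X -/Z in X01 Z01.
  have xE : degree_share G' i - Xs i = (X i - Xs i) + (a G' i - X i) / n.+1%:R.
    rewrite /X /degree_share tot tot' /a nS; field.
    by rewrite gt_eqF //= gt_eqF //= gt_eqF //; lra.
  have UE : degree_share G' i * (red_proportion R G' i - Zs i) =
      X i * (Z i - Zs i) + (b G' i - X i * (Z i - Zs i)) / n.+1%:R.
    rewrite !mulrBr /X /Z !degree_share_red // tot tot' /b /a /degree_share.
    rewrite tot tot' nS; field.
    by rewrite gt_eqF //= gt_eqF //= gt_eqF //; lra.
  rewrite xE UE; set e := a G' i - X i; set y := X i * (Z i - Zs i).
  have Zs2i := Zs2 i; rewrite ler_norml in Zs2i; case/andP: Zs2i => Zs_lo Zs_hi.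
  have Zs2i := Zs2 i.
  have e1 : e ^+ 2 <= 1 ^+ 2.
    by apply: sqr_le_of_norm; rewrite /e ler_norml; apply/andP; split; lra.
  have y3 : `|y| <= 1 * 3.
    by apply: norm_mul_le; rewrite ler_norml; apply/andP; split; lra.
  have b3 : `|b G' i| <= 3.
    have : `|Zs i * a G' i| <= 2 * 1.
      by apply: norm_mul_le => //; rewrite ler_norml; apply/andP; split; lra.
    by rewrite /b !ler_norml => /andP[? ?]; apply/andP; split; lra.
  have y6 : (b G' i - y) ^+ 2 <= 6 ^+ 2.
    apply: sqr_le_of_norm; move: y3 b3; rewrite !ler_norml => /andP[? ?] /andP[? ?].
    by apply/andP; split; lra.
  have k2 : 0 < (n.+1%:R ^+ 2)^-1 :> R by rewrite invr_gt0 exprn_gt0.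
  have : (e ^+ 2 + (b G' i - y) ^+ 2) / n.+1%:R ^+ 2 <= 37 / n.+1%:R ^+ 2.
    by rewrite ler_pM2r //; lra.
  move: (b G' i) => b'.
  have -> : (X i - Xs i + e / n.+1%:R) ^+ 2 + (y + (b' - y) / n.+1%:R) ^+ 2 =
    (X i - Xs i) ^+ 2 + y ^+ 2 +
    2 / n.+1%:R * ((X i - Xs i) * e + y * (b' - y)) +
    (e ^+ 2 + (b' - y) ^+ 2) / n.+1%:R ^+ 2.
    by field; rewrite gt_eqF.
  by move=> le37; rewrite lerD2l.
apply: le_trans (step_mean_le hmu hp pA (H := fun G' => energy Xs Zs G +
  2 / n.+1%:R * gain G' + 37 * N%:R / n.+1%:R ^+ 2) pointwise) _.
rewrite !step_meanD !step_mean_const // lerD2r lerD2l step_meanZ //.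
apply: ler_wpM2l; first by rewrite divr_ge0 ?ler0n.
rewrite le_eqVlt; apply/orP; left; apply/eqP.
rewrite /gain step_mean_sum //; apply: eq_bigr => i _.
have mean_a : step_mean mu A p G (a ^~ i) = inflow A mu X i.
  rewrite (step_mean_eq hmu hp pA (H := fun G' => s^-1 * weight G' i +
     (- (weight G i / s)))); last by move=> *; rewrite /a; ring.
  rewrite step_meanD step_meanZ step_mean_const // step_mean_weight //.
  by rewrite /X inflow_share // -/s; field; rewrite pnatr_eq0 -lt0n.
have mean_b : step_mean mu A p G (b ^~ i) =
    mu i / 2 * (rule_poly p).[mixture A X Z i] +
    (inflow A mu X i - mu i / 2) * Z i - Zs i * inflow A mu X i.
  rewrite (step_mean_eq hmu hp pA (H := fun G' => s^-1 * (red_degree G' i)%:R +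
     (- ((red_degree G i)%:R / s)) + (- Zs i) * a G' i)); last first.
    by move=> *; rewrite /b; ring.
  rewrite !step_meanD !step_meanZ step_mean_const // step_mean_red // mean_a.
  rewrite /X inflow_share // mixture_share // /s natrM /Z; field.
  by rewrite pnatr_eq0 -lt0n.
set x := X i - Xs i; set y := X i * (Z i - Zs i).
rewrite (step_mean_eq hmu hp pA (H := fun G' => x * a G' i + (y * b G' i +
   (- (x * X i + y * y))))); last by move=> *; ring.
by rewrite !step_meanD !step_meanZ step_mean_const // mean_a mean_b /y; field.
Qed.

End LyapunovStep.

Arguments total_degree {R N} m G.
Arguments degree_share {R N} m G i.
Arguments energy {R N} m Xs Zs G.

(** * Steering the process to the target *)

Section Steering.
Context {R : realType} {N m : nat}.
Variables (mu : 'I_N -> R) (A : 'M[R]_N) (p : 'I_m.+1 -> R) (G0 : cgraph N).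
Hypotheses (hmu : community_law mu) (hp : type_rule p) (pA : positive_diagonal A).
Hypotheses (m_gt0 : (0 < m)%N) (prG0 : proper m G0).
Implicit Types (G : cgraph N) (t k : nat) (a b : bool) (i x y : 'I_N).

Local Notation att := (attainable mu A p G0).

Definition rule_chance k b : R := if b then p (inord k) else 1 - p (inord k).

Lemma attach_prob_support G x v : proper m G -> 0 < attach_prob A G x v ->
  (v < nvertices G)%N.
Proof.
move=> pr; apply: contraTT => vn.
by rewrite attach_prob_notin ?ltxx //; case: pr.
Qed.

Lemma attainable_proper t G : att t G -> proper m G.
Proof.
elim=> // {}t {}G x w b _ pr _ wA _; apply: add_vertex_proper => // v /wA.
exact: attach_prob_support.
Qed.

Lemma attainable_nvertices t G : att t G -> nvertices G = (nvertices G0 + t)%N.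
Proof. by elim=> [|{}t {}G x w b _ IH _ _ _] /=; rewrite ?addn0 // IH addnS. Qed.

Definition coloured a G i :=
  exists v, [/\ (v < nvertices G)%N, red G v = a, comm G v = i & (0 < deg G v)%N].

Lemma coloured_add a G i x (w : m.-tuple nat) b :
  coloured a G i -> coloured a (add_vertex G x w b) i.
Proof.
case=> v [vn ra cv dv]; exists v; split=> /=.
- exact: ltnW.
- by rewrite ltn_eqF.
- by rewrite ltn_eqF.
by rewrite /deg /= !count_cat; move: dv; rewrite /deg; lia.
Qed.

Lemma coloured_new G x (w : m.-tuple nat) b : coloured b (add_vertex G x w b) x.
Proof.
exists (nvertices G); split; rewrite /= ?eqxx //.
have own : count (fun e : nat * nat => e.1 == nvertices G)
    [seq (nvertices G, u) | u <- w] = m.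
  rewrite count_map (eq_count (a2 := predT)) ?count_predT ?size_tuple // => v /=.
  by rewrite eqxx.
by rewrite /deg /= !count_cat own; have := m_gt0; lia.
Qed.

Lemma coloured_some G i : proper m G -> exists a, coloured a G i.
Proof.
case=> _ _ /(_ i) /degree_sum_gt0[v [vn /eqP cv dv]].
by exists (red G v), v.
Qed.

(** All neighbours are taken among two vertices, which is enough to prescribe the
number of red ones. *)
Lemma attach_two t G y v1 v2 k b : att t G -> (k <= m)%N ->
  0 < A (comm G v1) y -> (0 < deg G v1)%N ->
  0 < A (comm G v2) y -> (0 < deg G v2)%N ->
  0 < rule_chance (k * red G v1 + (m - k) * red G v2) b ->
  exists2 w : m.-tuple nat, w = nseq k v1 ++ nseq (m - k) v2 :> seq nat &
    att t.+1 (add_vertex G y w b).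
Proof.
move=> aG km A1 d1 A2 d2 ch; have pr := attainable_proper aG.
have sz : size (nseq k v1 ++ nseq (m - k) v2) == m by rewrite size_cat !size_nseq subnKC.
exists (Tuple sz) => //; apply: attainableS => //; first by case: hmu.
  move=> v; rewrite mem_cat => /orP[] /nseqP[-> _]; exact: (attach_prob_gt0 pA pr).
by rewrite /type_chance /red_chance /= count_cat !count_nseq mulnC [X in (_ + X)%N]mulnC;
  move: ch; rewrite /rule_chance; case: b.
Qed.

Definition enriches G G' := forall a i, coloured a G i -> coloured a G' i.

(** If [y] has no vertex of colour [a], then all its vertices have the other
colour, and a newcomer of [y] can combine them with vertices of [x] so as to see
any number of red neighbours; some number allows the colour [a]. *)
Lemma spread_colour t G a x y : att t G -> coloured a G x -> 0 < A x y ->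
  (exists2 k, (k <= m)%N & 0 < rule_chance k a) ->
  exists t' G', [/\ att t' G', enriches G G' & coloured a G' y].
Proof.
move=> aG [v [vn rv cv dv]] Axy [k km ch].
have [cy|ncy] := pselect (coloured a G y); first by exists t, G; split.
have [c [v0 [v0n rv0 cv0 dv0]]] := coloured_some y (attainable_proper aG).
have {}rv0 : red G v0 = ~~ a.
  have [ca|/negbTE] := boolP (c == a); last by rewrite rv0; case: (c) (a) => -[].
  by case: ncy; exists v0; rewrite rv0 (eqP ca).
have A0 : 0 < A (comm G v0) y by rewrite cv0; case: pA.
have A1 : 0 < A (comm G v) y by rewrite cv.
pose vr := if a then v else v0; pose vb := if a then v0 else v.
have [] := @attach_two t G y vr vb k a aG km.
- by rewrite /vr; case: ifP.
- by rewrite /vr; case: ifP.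
- by rewrite /vb; case: ifP.
- by rewrite /vb; case: ifP.
- rewrite /vr /vb; case: (a) rv rv0 ch => /= -> -> ch;
    by rewrite muln1 muln0 addn0.
move=> w _ aG'; exists t.+1, (add_vertex G y w a); split=> //.
  by move=> c' j; apply: coloured_add.
exact: coloured_new.
Qed.

(** If [y] has no vertex of colour [a], then a newcomer attached within [y] has
no neighbour of colour [a]. *)
Lemma spontaneous_colour t G a y : att t G ->
  0 < rule_chance (if a then 0 else m) a ->
  exists t' G', [/\ att t' G', enriches G G' & coloured a G' y].
Proof.
move=> aG ch.
have [cy|ncy] := pselect (coloured a G y); first by exists t, G; split.
have [c [v0 [v0n rv0 cv0 dv0]]] := coloured_some y (attainable_proper aG).
have {}rv0 : red G v0 = ~~ a.
  have [ca|/negbTE] := boolP (c == a); last by rewrite rv0; case: (c) (a) => -[].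
  by case: ncy; exists v0; rewrite rv0 (eqP ca).
have A0 : 0 < A (comm G v0) y by rewrite cv0; case: pA.
have [//|//|//|//||w _ aG'] := @attach_two t G y v0 v0 m a aG (leqnn m).
  by rewrite subnn mul0n addn0 rv0; case: (a) ch; rewrite /= ?muln0 ?muln1.
exists t.+1, (add_vertex G y w a); split=> //.
  by move=> c' j; apply: coloured_add.
exact: coloured_new.
Qed.

Lemma spread_along a x (s : seq 'I_N) t G : att t G -> coloured a G x ->
  path [rel x y | 0 < A x y] x s ->
  (exists2 k, (k <= m)%N & 0 < rule_chance k a) ->
  exists t' G', [/\ att t' G', enriches G G' & coloured a G' (last x s)].
Proof.
move=> aG cx ps chs; elim: s x t G aG cx ps => [|y s IHs] x t G aG cx /=.
  by move=> _; exists t, G; split.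
move=> /andP[Axy ps].
have [t' [G' [aG' GG' cy]]] := spread_colour aG cx Axy chs.
have [t'' [G'' [aG'' GG'' cl]]] := IHs _ _ _ aG' cy ps.
by exists t'', G''; split=> // c i /GG' /GG''.
Qed.

Lemma all_colours_attainable :
  (forall a, exists2 k, (k <= m)%N & 0 < rule_chance k a) ->
  (forall i a, 0 < rule_chance (if a then 0 else m) a \/
     exists x, coloured a G0 x /\ connect [rel x y | 0 < A x y] x i) ->
  exists t G, att t G /\ forall a i, coloured a G i.
Proof.
move=> chs source.
have one t G a i : att t G -> enriches G0 G ->
    exists t' G', [/\ att t' G', enriches G G' & coloured a G' i].
  move=> aG GG; have [ch|[x [cx /connectP[s ps ->]]]] := source i a.
    exact: spontaneous_colour aG ch.
  exact: spread_along aG (GG _ _ cx) ps (chs a).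
have [t [G [aG _ all_s]]] : exists t G, [/\ att t G, enriches G0 G &
    forall ai, ai \in index_enum (bool * 'I_N)%type -> coloured ai.1 G ai.2].
  elim: (index_enum _) => [|[a i] s [t [G [aG GG all_s]]]].
    by exists 0, G0; split=> //; constructor.
  have [t' [G' [aG' GG' ci]]] := one t G a i aG GG.
  exists t', G'; split=> //; first by move=> c j /GG /GG'.
  by move=> ai; rewrite inE => /orP[/eqP ->//|/all_s /GG'].
by exists t, G; split=> // a i; apply: (all_s (a, i)); rewrite mem_index_enum.
Qed.

Lemma steer_step t G i k b : att t G -> (forall a i, coloured a G i) -> (k <= m)%N ->
  0 < rule_chance k b ->
  exists G', [/\ att t.+1 G', forall a i, coloured a G' i,
    forall j, comm_degree G' j = (comm_degree G j + 2 * m * (i == j))%N &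
    forall j, red_degree G' j = (red_degree G j + (m * b + k) * (i == j))%N].
Proof.
move=> aG full km ch.
have [v1 [v1n r1 c1 d1]] := full true i; have [v2 [v2n r2 c2 d2]] := full false i.
have Ai : 0 < A i i by case: pA.
have [|||w wE aG'] := @attach_two t G i v1 v2 k b aG km _ d1 _ d2.
- by rewrite c1.
- by rewrite c2.
- by rewrite r1 r2 muln1 muln0 addn0.
have w_lt v : v \in w -> (v < nvertices G)%N.
  by rewrite memtE wE mem_cat => /orP[] /nseqP[-> _].
have pr := attainable_proper aG.
exists (add_vertex G i w b); split=> // [a j|j|j].
- exact: coloured_add.
- rewrite comm_degree_add // wE big_cat /= !big_nseq !iter_addn_0.
  by rewrite c1 c2; case: (i == j); lia.
rewrite red_degree_add // wE big_cat /= !big_nseq !iter_addn_0.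
by rewrite r1 r2 c1 c2; case: (i == j); case: (b) => /=; lia.
Qed.

Lemma mean_exceeded (K : finType) (wt f : K -> R) (c : R) :
  (forall l, 0 <= wt l) -> \sum_l wt l = 1 -> \sum_l wt l * f l = c ->
  exists2 l, 0 < wt l & c <= f l.
Proof.
move=> wt0 wt1 mean; apply: contrapT => none.
have lt_c l : 0 < wt l -> f l < c.
  by move=> w0; rewrite ltNge; apply/negP => cf; apply: none; exists l.
have sum0 : \sum_l wt l * (c - f l) = 0.
  under eq_bigr do rewrite mulrBr.
  by rewrite sumrB mean -mulr_suml wt1 mul1r subrr.
have all0 l : wt l = 0.
  apply/eqP; apply: contrapT => /negP wl; have w0 : 0 < wt l by rewrite lt0r wl wt0.
  have : wt l * (c - f l) = 0.
    apply: (psumr_eq0P _ sum0) => // j _.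
    have [->|wj] := eqVneq (wt j) 0; first by rewrite mul0r.
    by rewrite mulr_ge0 // subr_ge0 ltW // lt_c // lt0r wj wt0.
  by apply/eqP; rewrite mulf_neq0 // subr_eq0 gt_eqF // lt_c.
by move: wt1; rewrite big1 // => /eqP; rewrite eq_sym oner_eq0.
Qed.

Lemma rule_chance_ge0 k b : 0 <= rule_chance k b.
Proof. by have := hp (inord k); rewrite /rule_chance; case: b; lra. Qed.

Section FixedPointIncrement.
Variable z : R.
Hypotheses (z01 : 0 <= z <= 1) (zfix : (rule_poly p).[z] = z).

Let coin (c : bool) : R := if c then z else 1 - z.
Let wt (l : {ffun 'I_m -> bool} * bool) : R :=
  (\prod_j coin (l.1 j)) * rule_chance (\sum_j l.1 j)%N l.2.

Let coin1 : \sum_c coin c = 1.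
Proof. by rewrite big_bool /=; ring. Qed.

Let wt_ge0 l : 0 <= wt l.
Proof.
have z01' := z01; rewrite mulr_ge0 ?rule_chance_ge0 ?prodr_ge0 // => j _.
by rewrite /coin; case: (l.1 j); lra.
Qed.

Let wt_total : \sum_l wt l = 1.
Proof.
rewrite -(pair_bigA _ (fun (u : {ffun 'I_m -> bool}) b =>
  (\prod_j coin (u j)) * rule_chance (\sum_j u j)%N b)) /=.
rewrite -[RHS](sample_total m coin1); apply: eq_bigr => u _.
rewrite big_bool /rule_chance /=; ring.
Qed.

Let wt_mean : \sum_l wt l * (m * l.2 + \sum_j l.1 j)%N%:R = (2 * m)%:R * z.
Proof.
rewrite -(pair_bigA _ (fun (u : {ffun 'I_m -> bool}) b =>
  (\prod_j coin (u j)) * rule_chance (\sum_j u j)%N b *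
  (m * b + \sum_j u j)%N%:R)) /=.
transitivity (\sum_(u : {ffun 'I_m -> bool})
   (m%:R * ((\prod_j coin (u j)) * p (inord (\sum_j u j)%N)) +
    (\prod_j coin (u j)) * \sum_j (u j)%:R)).
  apply: eq_bigr => u _; rewrite big_bool /= muln1 muln0 add0n natrD natr_sum.
  by set s := \sum_j _; rewrite /rule_chance; ring.
rewrite big_split /= -mulr_sumr (sample_mean m coin1 (fun c : bool => c%:R)).
rewrite (sample_count m coin1 (fun c : bool => c) (fun k => p (inord k))).
have -> : \sum_(c : bool | c) coin c = z.
  by rewrite (big_pred1 true) // => -[].
have -> : \sum_(k < m.+1) 'C(m, k)%:R * (z ^+ k * (1 - z) ^+ (m - k)) * p (inord k)
    = (rule_poly p).[z].
  by rewrite rule_polyE; apply: eq_bigr => k _; rewrite inord_val.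
by rewrite zfix big_bool /= natrM; ring.
Qed.

Let count_le (u : {ffun 'I_m -> bool}) : (\sum_j u j <= m)%N.
Proof.
apply: (@leq_trans (\sum_(j < m) 1)); first by apply: leq_sum => j _; case: (u j).
by rewrite sum_nat_const card_ord muln1.
Qed.

Let wt_support l : 0 < wt l -> 0 < rule_chance (\sum_j l.1 j)%N l.2.
Proof.
by rewrite lt0r mulf_eq0 negb_or => /andP[/andP[_ h] _]; rewrite lt0r h rule_chance_ge0.
Qed.

(** For a newcomer attached within community i, [m * b + k] is the number of red
edge-ends brought by type [b] with [k] red neighbours. Its mean is
m R(z) + m z = 2 m z if k is binomial with parameter z and z is a fixed point. *)
Lemma increment_above : exists k b, [/\ (k <= m)%N, 0 < rule_chance k b &
  (2 * m)%:R * z <= (m * b + k)%:R].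
Proof.
have [[u b] w0 le] := mean_exceeded wt_ge0 wt_total wt_mean.
by exists (\sum_j u j)%N, b; split; [exact: count_le | exact: wt_support w0 |].
Qed.

Lemma increment_below : exists k b, [/\ (k <= m)%N, 0 < rule_chance k b &
  (m * b + k)%:R <= (2 * m)%:R * z].
Proof.
have mean_opp : \sum_l wt l * - (m * l.2 + \sum_j l.1 j)%N%:R = - ((2 * m)%:R * z).
  by rewrite -wt_mean -sumrN; apply: eq_bigr => l _; rewrite mulrN.
have [[u b] w0 le] := mean_exceeded wt_ge0 wt_total mean_opp.
exists (\sum_j u j)%N, b; split; [exact: count_le | exact: wt_support w0 |].
by rewrite -lerN2.
Qed.

(** A step of size at most [B] against the sign of the excess. *)
Lemma increment_correcting (r : R) (B : R) : (2 * m)%:R <= B -> `|r| <= B ->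
  exists k b, [/\ (k <= m)%N, 0 < rule_chance k b &
    `|r + ((m * b + k)%:R - (2 * m)%:R * z)| <= B].
Proof.
move=> mB rB; have z01' := z01.
have small k b : (k <= m)%N -> 0 <= ((m * b + k)%:R : R) <= (2 * m)%:R.
  by move=> km; rewrite ler0n ler_nat; case: b; lia.
have s0 : 0 <= (2 * m)%:R :> R by [].
have zm : 0 <= (2 * m)%:R * z <= (2 * m)%:R.
  by rewrite mulr_ge0 //= ?ler_piMr //; lra.
have [r0|r0] := leP r 0.
  have [k [b [km ch le]]] := increment_above; exists k, b; split=> //.
  have := small k b km; move: rB; rewrite !ler_norml => /andP[? ?] /andP[? ?].
  by case/andP: zm => ? ?; apply/andP; split; lra.
have [k [b [km ch le]]] := increment_below; exists k, b; split=> //.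
have := small k b km; move: rB; rewrite !ler_norml => /andP[? ?] /andP[? ?].
by case/andP: zm => ? ?; apply/andP; split; lra.
Qed.

End FixedPointIncrement.

Definition excess G i : R := weight G i - total_degree m G * mu i.

Definition red_excess (z : 'I_N -> R) G i : R := (red_degree G i)%:R - z i * weight G i.

Lemma excess_total G : proper m G -> \sum_i excess G i = 0.
Proof.
move=> pr; rewrite sumrB -mulr_sumr; case: hmu => _ ->; rewrite mulr1.
by rewrite /weight -natr_sum (comm_degree_total pr) subrr.
Qed.

(** Each newcomer joins a community whose excess is not positive, which exists
since the excesses add up to 0, and brings a correcting number of red edge-ends
into it. The other communities keep their red excess, and their excess
decreases. *)
Lemma bounded_excess_attainable z t0 G : (0 < N)%N -> (forall i, 0 <= z i <= 1) ->
  (forall i, (rule_poly p).[z i] = z i) ->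
  att t0 G -> (forall a i, coloured a G i) ->
  exists B : R, forall s, exists G', [/\ att (t0 + s) G', (forall a i, coloured a G' i),
    forall i, excess G' i <= B & forall i, `|red_excess z G' i| <= B].
Proof.
move=> N0 z01 zfix aG full; have i0 : 'I_N by case: N N0 => // n _; exact: ord0.
pose B : R := (2 * m)%:R + \sum_i `|excess G i| + \sum_i `|red_excess z G i|.
have sum_ge (f : 'I_N -> R) i : `|f i| <= \sum_j `|f j|.
  by rewrite (bigD1 i) //= lerDl; apply: sumr_ge0.
have sum0 (f : 'I_N -> R) : 0 <= \sum_j `|f j| by apply: sumr_ge0.
have e0 := sum0 (excess G); have r0 := sum0 (red_excess z G).
have mB : (2 * m)%:R <= B by rewrite /B; lra.
exists B; elim=> [|s [G' [aG' full' eB rB]]].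
  have m0 : 0 <= (2 * m)%:R :> R by [].
  exists G; split=> // [|i|i]; first by rewrite addn0.
    by apply: le_trans (ler_norm _) _; have := sum_ge (excess G) i; rewrite /B; lra.
  by have := sum_ge (red_excess z G) i; rewrite /B; lra.
have pr := attainable_proper aG'.
have [i ei] : exists i, excess G' i <= 0.
  apply: contrapT => none.
  have pos i : 0 < excess G' i by rewrite ltNge; apply/negP => le; apply: none; exists i.
  have : 0 < \sum_i excess G' i.
    by rewrite (bigD1 i0) //= ltr_pwDl // sumr_ge0 // => i _; apply: ltW.
  by rewrite excess_total // ltxx.
have [k [b [km ch rB']]] := increment_correcting (z01 i) (zfix i) mB (rB i).
have [G'' [aG'' full'' cE rE]] := steer_step i aG' full' km ch.
have nE : nvertices G'' = (nvertices G').+1.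
  by rewrite (attainable_nvertices aG'') (attainable_nvertices aG') addnS.
have tE : total_degree m G'' = total_degree m G' + (2 * m)%:R :> R.
  by rewrite /total_degree nE mulnS addnC natrD.
have m0 : 0 <= (2 * m)%:R :> R by [].
exists G''; rewrite addnS; split=> // j.
  have [mu0 _] := hmu; have muj := mu0 j.
  have mmu : 0 <= (2 * m)%:R * mu j by rewrite mulr_ge0 // ltW.
  rewrite /excess /weight cE tE.
  have := eB j; rewrite /excess /weight; case: eqP => [ij|_].
    by move: ei; rewrite muln1 natrD -ij /excess /weight in mmu *; lra.
  by rewrite muln0 addn0; lra.
rewrite /red_excess /weight cE rE; case: eqP => [<-|_]; last by rewrite !muln0 !addn0; apply: rB.
rewrite !muln1; set inc := (m * b + k)%N in rB' *.
have -> : (red_degree G' i + inc)%:R - z i * (comm_degree G' i + 2 * m)%:R =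
   red_excess z G' i + (inc%:R - (2 * m)%:R * z i).
  by rewrite !natrD /red_excess /weight; ring.
exact: rB'.
Qed.

(** Upper bounds on the excesses give lower bounds, as the sum is 0. Division by
the growing degrees turns bounded excesses into small deviations. *)
Lemma target_attainable z : (0 < N)%N -> (forall i, 0 <= z i <= 1) ->
  (forall i, (rule_poly p).[z i] = z i) ->
  (exists t G, att t G /\ forall a i, coloured a G i) ->
  forall eta : R, 0 < eta -> forall n0 : nat, exists t G,
    [/\ att t G, (n0 <= nvertices G)%N &
        near_target mu z eta (degree_share m G) (red_proportion R G)].
Proof.
move=> N0 z01 zfix [t0 [G [aG full]]] eta eta0 n0.
have [B steer] := bounded_excess_attainable N0 z01 zfix aG full.
have [mu0 _] := hmu; have [c c0 c_mu] := uniform_pos mu0.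
have i0 : 'I_N by case: N N0 => // n _; exact: ord0.
have B0 : 0 <= B.
  by have [G' [_ _ _ /(_ i0)]] := steer 0%N; apply: le_trans.
have NB0 : 0 <= N%:R * B by rewrite mulr_ge0.
pose K : R := (N%:R * B / eta + (B / eta + N%:R * B) / c).
have K1 : 0 <= N%:R * B / eta by rewrite divr_ge0 // ltW.
have K2 : 0 <= (B / eta + N%:R * B) / c.
  by rewrite divr_ge0 ?addr_ge0 ?divr_ge0 // ltW.
pose s := (n0 + Num.bound K)%N.
have [G' [aG' _ eB rB]] := steer s.
have pr := attainable_proper aG'.
exists (t0 + s)%N, G'; have nE := attainable_nvertices aG'.
split=> //; first by rewrite nE /s; lia.
have KT : K <= total_degree m G'.
  have Kb := archi_boundP (addr_ge0 K1 K2 : 0 <= K).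
  apply: le_trans (ltW Kb) _; rewrite ler_nat nE /s.
  by have := m_gt0; nia.
set TT := total_degree m G' in KT *.
have T0 : 0 < TT := total_degree_gt0 m_gt0 i0 pr.
have eN i : `|excess G' i| <= N%:R * B.
  have others : \sum_(j | j != i) excess G' j <= N%:R * B.
    apply: (@le_trans _ _ (\sum_(j < N | j != i) B)); first exact: ler_sum.
    apply: (@le_trans _ _ (\sum_(j < N) B)); last first.
      by rewrite sumr_const card_ord mulr_natl.
    by rewrite [leRHS](bigD1 i) //= lerDr.
  have := excess_total pr; rewrite (bigD1 i) //= => tot.
  have N1 : B <= N%:R * B by rewrite ler_peMl // ler1n.
  rewrite ler_norml; apply/andP; split; first lra.
  exact: le_trans (eB i) N1.
move=> i; have e_i := eN i; have r_i := rB i; have w0 : 0 < (weight G' i : R) := weight_gt0 i pr.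
have mui := c_mu i.
split.
  have -> : degree_share m G' i - mu i = excess G' i / TT.
    by rewrite /degree_share /excess -/TT mulrBl [TT * _]mulrC mulfK // gt_eqF.
  rewrite normrM normfV (gtr0_norm T0) ler_pdivrMr //; apply: le_trans e_i _.
  have : N%:R * B / eta <= TT by apply: le_trans KT; rewrite /K; lra.
  by rewrite ler_pdivrMr // [eta * _]mulrC.
have -> : red_proportion R G' i - z i = red_excess z G' i / weight G' i.
  by rewrite /red_excess red_proportionE mulrBl mulfK ?(gt_eqF w0).
rewrite normrM normfV (gtr0_norm w0) ler_pdivrMr //; apply: le_trans r_i _.
have : (B / eta + N%:R * B) / c <= TT by apply: le_trans KT; rewrite /K; lra.
rewrite ler_pdivrMr // => h.
have : TT * c <= TT * mu i by rewrite ler_pM2l.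
move: e_i; rewrite ler_norml /excess -/TT => /andP[e1 _] h2.
have : B / eta <= weight G' i by lra.
by rewrite ler_pdivrMr // [eta * _]mulrC.
Qed.

End Steering.

(** * A slowly growing multiplier *)

Section Multiplier.
Context {R : realType}.

(** Its relative growth, at most gam / n, is slower than the decay of the energy,
but it is unbounded. *)
Definition multiplier (gam : R) (n0 n : nat) : R :=
  1 + gam * (series harmonic n - series harmonic n0).

Lemma multiplierS (gam : R) n0 n :
  multiplier gam n0 n.+1 = multiplier gam n0 n + gam / n.+1%:R.
Proof. by rewrite /multiplier seriesEnat /= big_nat_recr //= /harmonic; ring. Qed.

Lemma multiplier_start (gam : R) n0 : multiplier gam n0 n0 = 1.
Proof. by rewrite /multiplier subrr mulr0 addr0. Qed.

Lemma multiplier_ge1 (gam : R) n0 n : 0 <= gam -> (n0 <= n)%N ->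
  1 <= multiplier gam n0 n.
Proof.
move=> g0; elim: n => [|n IHn].
  by rewrite leqn0 => /eqP ->; rewrite multiplier_start.
rewrite leq_eqVlt => /orP[/eqP ->|]; first by rewrite multiplier_start.
rewrite ltnS => /IHn le1; rewrite multiplierS; apply: le_trans le1 _.
by rewrite lerDl divr_ge0.
Qed.

Lemma multiplier_unbounded (gam : R) n0 (M : R) : 0 < gam ->
  exists n1, forall n, (n1 <= n)%N -> M <= multiplier gam n0 n.
Proof.
move=> g0; apply: contrapT => none.
have nd : nondecreasing_seq (series (@harmonic R)).
  by apply: nondecreasing_series => k _ _; apply/ltW/harmonic_gt0.
apply: (@dvg_harmonic R); apply: nondecreasing_is_cvgn => //.
exists ((M - 1) / gam + series harmonic n0) => _ [n1 _ <-].
rewrite leNgt; apply/negP => lt_n1; apply: none; exists n1 => n n1n.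
have := nd _ _ n1n; rewrite /multiplier => le_n.
have : (M - 1) / gam < series harmonic n - series harmonic n0 by lra.
by rewrite ltr_pdivrMr // mulrC; lra.
Qed.

(** The noise of order C / n^2 is absorbed by the decrease of 4 C / (n - 1), and
the growth of the multiplier by the factor 1 - c / n in front of the energy. *)
Lemma multiplier_supermartingale (gam c C : R) n0 n (V V' : R) :
  (n0 <= n)%N -> (1 < n)%N -> 0 < gam -> gam <= c -> gam <= 1 / 2 -> 0 <= C -> 0 <= V ->
  V' <= V + 2 / n.+1%:R * (- c * V) + C / n.+1%:R ^+ 2 ->
  multiplier gam n0 n.+1 * (V' + 4 * C / n%:R) <=
  multiplier gam n0 n * (V + 4 * C / n.-1%:R).
Proof.
move=> n0n n1 g0 gc g12 C0 V0 step; rewrite multiplierS.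
set g := multiplier gam n0 n; have g1 : 1 <= g by apply: multiplier_ge1 (ltW _) _.
(* Here n becomes k + 2, so that n - 1 is not 0. *)
case: n n1 n0n step @g g1 => [//|[//|k]] _ _ step g g1 /=.
set u : R := k.+3%:R^-1 in step *; set v : R := k.+2%:R^-1; set w : R := k.+1%:R^-1.
have k0 : 0 <= k%:R :> R by [].
have e1 : k.+1%:R = k%:R + 1 :> R by rewrite -addn1 natrD.
have e2 : k.+2%:R = k%:R + 2 :> R by rewrite -addn2 natrD.
have e3 : k.+3%:R = k%:R + 3 :> R by rewrite -addn3 natrD.
have u0 : 0 < u by rewrite invr_gt0.
have v0 : 0 < v by rewrite invr_gt0.
have uv : u <= v by rewrite lef_pV2 ?posrE // e2 e3; lra.
have vu : v <= 2 * u.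
  by rewrite /u /v ler_pdivlMr // mulrC ler_pdivrMr // e2 e3; lra.
have v1 : v <= 1 by rewrite invf_le1 ?ler1n.
have wv : v + v ^+ 2 <= w.
  have -> : w = v + v * w by rewrite /v /w e1 e2; field; rewrite !gt_eqF //=; lra.
  rewrite lerD2l expr2 ler_pM2l // lef_pV2 ?posrE // e1 e2; lra.
have V'le : V' <= V * (1 - c * v) + C * v ^+ 2.
  apply: le_trans step _; rewrite -exprVn -/u.
  have h1 : c * V * v <= c * V * (2 * u) by rewrite ler_wpM2l // mulr_ge0 //; lra.
  have h2 : C * u ^+ 2 <= C * v ^+ 2.
    by rewrite ler_wpM2l // !expr2 ler_pM // ltW.
  lra.
have fac : g + gam * u <= g * (1 + gam * v).
  have : gam * u <= gam * v by rewrite ler_pM2l.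
  have : gam * v <= g * (gam * v) by rewrite ler_peMl // mulr_ge0 // ltW.
  lra.
have inner : (1 + gam * v) * (V * (1 - c * v) + C * v ^+ 2 + 4 * C * v) <=
    V + 4 * C * w.
  have h1 : 0 <= V * v * (c - gam) by rewrite !mulr_ge0 ?(ltW v0) //; lra.
  have h2 : 0 <= V * (c * v * (gam * v)).
    by rewrite !mulr_ge0 ?(ltW v0) ?(ltW g0) //; lra.
  have h3 : 4 * C * (v + v ^+ 2) <= 4 * C * w by rewrite ler_wpM2l //; lra.
  have v2 : 0 <= C * v ^+ 2 by rewrite mulr_ge0 // sqr_ge0.
  have h4 : C * v ^+ 2 * gam <= C * v ^+ 2 * (1 / 2) by rewrite ler_wpM2l.
  have h5 : C * v ^+ 2 * gam * v <= C * v ^+ 2 * gam * 1.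
    by rewrite ler_wpM2l // mulr_ge0 // ltW.
  have -> : (1 + gam * v) * (V * (1 - c * v) + C * v ^+ 2 + 4 * C * v) =
    V - V * v * (c - gam) - V * (c * v * (gam * v)) + C * v ^+ 2 + 4 * C * v +
    C * v ^+ 2 * gam * v + 4 * (C * v ^+ 2 * gam) by ring.
  lra.
have gg : 0 <= g + gam * u by have := mulr_gt0 g0 u0; lra.
apply: (@le_trans _ _ ((g + gam * u) * (V * (1 - c * v) + C * v ^+ 2 + 4 * C * v))).
  by rewrite ler_wpM2l // lerD2r.
have [h|/ltW h] := leP 0 (V * (1 - c * v) + C * v ^+ 2 + 4 * C * v).
  apply: (@le_trans _ _ (g * (1 + gam * v) * (V * (1 - c * v) + C * v ^+ 2 + 4 * C * v))).
    by rewrite ler_wpM2r.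
  by rewrite -mulrA ler_wpM2l //; lra.
have w0 : 0 <= w by rewrite invr_ge0.
apply: (@le_trans _ _ 0); first by rewrite mulr_ge0_le0.
by rewrite mulr_ge0 //; [lra | rewrite addr_ge0 ?mulr_ge0].
Qed.

End Multiplier.

(** * Measurability of limit events *)

Section LimitEvents.
Context {R : realType} {N m : nat} {d : measure_display} {T : measurableType d}.
Variables (P : probability T R) (C : nat -> T -> 'I_N).
Variables (W : nat -> T -> m.-tuple nat) (B : nat -> T -> bool).
Variables (mu : 'I_N -> R) (A : 'M[R]_N) (p : 'I_m.+1 -> R) (G0 : cgraph N).
Hypothesis model : pa_model C W B P mu A p G0.

Let u i t o := red_proportion R (random_graph C W B G0 t o) i.

Lemma measurable_eventually (S : nat -> nat -> nat -> set T) :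
  (forall k n t, measurable (S k n t)) ->
  measurable [set o | forall k, exists n, forall t, (n <= t)%N -> S k n t o] /\
  measurable [set o | exists k, exists n, forall t, (n <= t)%N -> S k n t o].
Proof.
move=> mS; have mI k n : measurable (\bigcap_(t in [set t | (n <= t)%N]) S k n t).
  by apply: bigcap_measurable => //; exists n => /=.
have mU k : measurable (\bigcup_n \bigcap_(t in [set t | (n <= t)%N]) S k n t).
  exact: bigcup_measurable.
split.
  rewrite (_ : [set o | _] = \bigcap_k \bigcup_n
      \bigcap_(t in [set t | (n <= t)%N]) S k n t).
    by apply: bigcap_measurable => //; exists 0%N.
  apply/seteqP; split=> o h k; first by move=> _; have [n hn] := h k; exists n.
  by have [n _ hn] := h k I; exists n.
rewrite (_ : [set o | _] = \bigcup_k \bigcup_n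
    \bigcap_(t in [set t | (n <= t)%N]) S k n t).
  exact: bigcup_measurable.
by apply/seteqP; split=> o; [move=> [k [n h]]; exists k => //; exists n |
  move=> [k _ [n _ h]]; exists k, n].
Qed.

Lemma measurable_proportion i t : measurable_fun setT (u i t).
Proof.
move=> _ Y mY; rewrite setTI.
exact: (measurable_graph model t (fun G => Y (red_proportion R G i))).
Qed.

Lemma measurable_le_level (f : T -> R) (e : R) : measurable_fun setT f ->
  measurable [set o | f o <= e] /\ measurable [set o | e <= f o].
Proof.
move=> mf; split; rewrite -[X in measurable X]setTI.
  by rewrite (_ : [set o | _] = f @^-1` `]-oo, e]); [exact: mf |
    apply/seteqP; split=> o /=; rewrite in_itv].
by rewrite (_ : [set o | _] = f @^-1` `[e, +oo[); [exact: mf |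
  apply/seteqP; split=> o /=; rewrite in_itv /= andbT].
Qed.

Definition cauchy_at (x : nat -> R) :=
  forall k, exists n, forall t, (n <= t)%N -> `|x t - x n| <= k.+1%:R^-1.

Lemma inv_nat_small (e : R) : 0 < e -> exists k : nat, k.+1%:R^-1 < e.
Proof.
move=> e0; have ei : 0 <= e^-1 by rewrite invr_ge0 ltW.
exists (Num.bound e^-1); rewrite invf_plt ?posrE //.
by apply: lt_trans (archi_boundP ei) _; rewrite ltr_nat.
Qed.

Lemma cvg_le_eventually (x : nat -> R) (l e : R) : x @ \oo --> l -> 0 < e ->
  exists n, forall t, (n <= t)%N -> `|l - x t| < e.
Proof. by move=> /cvgrPdist_lt /(_ e) h /h [n _ hn]; exists n => t; apply: hn. Qed.

Lemma cauchy_atP (x : nat -> R) : (exists l : R, x @ \oo --> l) <-> cauchy_at x.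
Proof.
split=> [[l xl] k|cx].
  have k0 : 0 < k.+1%:R^-1 / 2 :> R by rewrite divr_gt0 ?invr_gt0.
  have [n hn] := cvg_le_eventually xl k0; exists n => t nt.
  have := hn t nt; have := hn n (leqnn n); rewrite !ltr_norml ler_norml.
  move: (k.+1%:R^-1) => a; move=> /andP[? ?] /andP[? ?]; apply/andP; split; lra.
suff : cvg (x @ \oo) by move=> h; exists (lim (x @ \oo)).
apply: cauchy_cvg; apply: cauchy_exP => e e0.
have [k ke] := inv_nat_small e0; have [n hn] := cx k.
exists (x n), n => // t nt; rewrite /ball /= distrC; exact: le_lt_trans (hn t nt) ke.
Qed.

Lemma measurable_cauchy i : measurable [set o | cauchy_at (u i ^~ o)].
Proof.
pose S k n t := [set o | `|u i t o - u i n o| <= k.+1%:R^-1].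
suff mS k n t : measurable (S k n t) by exact: (measurable_eventually mS).1.
have mf : measurable_fun setT (fun o => `|u i t o - u i n o|).
  apply: measurableT_comp => //.
  by apply: measurable_realfun.measurable_funB; apply: measurable_proportion.
exact: (measurable_le_level _ mf).1.
Qed.

Lemma fin_forall_measurable (K : finType) (S : K -> set T) :
  (forall i, measurable (S i)) -> measurable [set o | forall i, S i o].
Proof.
move=> mS; rewrite (_ : [set o | _] = ~` \bigcup_i ~` S i).
  apply: measurableC; apply: countable_bigcupT_measurable => [|i].
    exact: countableP.
  exact: measurableC.
rewrite setC_bigcup; apply/seteqP; split=> o h i; first by move=> _ /(_ (h i)).
by apply: contrapT => nS; apply: (h i I).
Qed.

(** The limit is within [eps] exactly if, eventually, the sequence is within
[eps] with some margin. *)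
Lemma measurable_limits_near (z : 'I_N -> R) (eps : R) :
  measurable [set o | exists zt : 'I_N -> R, forall i,
    `|z i - zt i| < eps /\ u i t o @[t --> \oo] --> zt i].
Proof.
pose S i := [set o | cauchy_at (u i ^~ o)] `&`
  [set o | exists k, exists n, forall t, (n <= t)%N ->
     `|z i - u i t o| <= eps - k.+1%:R^-1].
have mS i : measurable (S i).
  apply: measurableI; first exact: measurable_cauchy.
  pose S' (k n t : nat) := [set o | `|z i - u i t o| <= eps - k.+1%:R^-1].
  suff mS' k n t : measurable (S' k n t) by exact: (measurable_eventually mS').2.
  have mf : measurable_fun setT (fun o => `|z i - u i t o|).
    apply: measurableT_comp => //.
    by apply: measurable_realfun.measurable_funB => //; apply: measurable_proportion.
  exact: (measurable_le_level _ mf).1.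
rewrite (_ : [set o | _] = [set o | forall i, S i o]); first exact: fin_forall_measurable.
apply/seteqP; split=> o /=.
  move=> [zt h] i; have [close cv] := h i; split; first by apply/cauchy_atP; exists (zt i).
  have gap : 0 < (eps - `|z i - zt i|) / 2 by rewrite divr_gt0 ?subr_gt0.
  have [k kg] := inv_nat_small gap; have [n hn] := cvg_le_eventually cv gap.
  exists k, n => t nt; have := hn t nt => ht.
  rewrite (_ : z i - _ = (z i - zt i) + (zt i - u i t o)); last by ring.
  apply: le_trans (ler_normD _ _) _.
  by move: (k.+1%:R^-1) kg => a kg; lra.
move=> h; have lims i : exists l : R, `|z i - l| < eps /\ u i t o @[t --> \oo] --> l.
  have [/cauchy_atP[l ul] [k [n hn]]] := h i; exists l; split=> //.
  have k0 : 0 < k.+1%:R^-1 :> R by rewrite invr_gt0.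
  have [n' hn'] := cvg_le_eventually ul k0.
  have h1 := hn (maxn n n') (leq_maxl _ _); have h2 := hn' (maxn n n') (leq_maxr _ _).
  rewrite (_ : z i - l = (z i - u i (maxn n n') o) - (l - u i (maxn n n') o)); last by ring.
  apply: le_lt_trans (ler_normB _ _) _.
  by move: (k.+1%:R^-1) k0 h1 h2 => a k0 h1 h2; lra.
by have [zt hzt] := choice lims; exists zt.
Qed.

Lemma measurable_limits_differ :
  measurable [set o | exists zt : 'I_N -> R,
    (forall i, u i t o @[t --> \oo] --> zt i) /\ (exists i j, zt i != zt j)].
Proof.
pose S (ij : 'I_N * 'I_N) := [set o | exists k, exists n, forall t, (n <= t)%N ->
     k.+1%:R^-1 <= `|u ij.1 t o - u ij.2 t o|].
have mS ij : measurable (S ij).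
  pose S' (k n t : nat) := [set o | k.+1%:R^-1 <= `|u ij.1 t o - u ij.2 t o|].
  suff mS' k n t : measurable (S' k n t) by exact: (measurable_eventually mS').2.
  have mf : measurable_fun setT (fun o => `|u ij.1 t o - u ij.2 t o|).
    apply: measurableT_comp => //.
    by apply: measurable_realfun.measurable_funB; apply: measurable_proportion.
  exact: (measurable_le_level _ mf).2.
rewrite (_ : [set o | _] = [set o | forall i, cauchy_at (u i ^~ o)] `&` \bigcup_ij S ij).
  apply: measurableI.
    exact: (fin_forall_measurable (S := fun i => [set o | cauchy_at (u i ^~ o)])
      measurable_cauchy).
  by apply: countable_bigcupT_measurable => //; exact: countableP.
apply/seteqP; split=> o /=.
  move=> [zt [cv [i [j ij]]]]; split=> [l|]; first by apply/cauchy_atP; exists (zt l).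
  exists (i, j) => //=.
  have gap : 0 < `|zt i - zt j| / 3 by rewrite divr_gt0 // normr_gt0 subr_eq0.
  have [k kg] := inv_nat_small gap.
  have [n hn] := cvg_le_eventually (cv i) gap; have [n' hn'] := cvg_le_eventually (cv j) gap.
  exists k, (maxn n n') => t nt.
  have h1 := hn t (leq_trans (leq_maxl _ _) nt); have h2 := hn' t (leq_trans (leq_maxr _ _) nt).
  have : `|zt i - zt j| <= `|zt i - u i t o| + `|u i t o - u j t o| + `|zt j - u j t o|.
    rewrite (_ : zt i - zt j = (zt i - u i t o) + (u i t o - u j t o) - (zt j - u j t o));
      last by ring.
    by apply: le_trans (ler_normB _ _) _; rewrite lerD2r ler_normD.
  by move: (k.+1%:R^-1) kg => a kg; lra.
move=> [cs [[i j] _ [k [n hn]]]].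
have lims l : exists v : R, u l t o @[t --> \oo] --> v by apply/cauchy_atP.
have [zt hzt] := choice lims; exists zt; split=> //; exists i, j.
apply/eqP => ztij; have k0 : 0 < k.+1%:R^-1 / 2 :> R by rewrite divr_gt0 ?invr_gt0.
have [n1 h1] := cvg_le_eventually (hzt i) k0; have [n2 h2] := cvg_le_eventually (hzt j) k0.
pose t := maxn n (maxn n1 n2).
have {}h1 := h1 t (leq_trans (leq_maxl _ _) (leq_maxr _ _)).
have {}h2 := h2 t (leq_trans (leq_maxr _ _) (leq_maxr _ _)).
have := hn t (leq_maxl _ _) => /=.
rewrite (_ : u i t o - u j t o = (zt j - u j t o) - (zt i - u i t o)); last first.
  by rewrite ztij; ring.
have := ler_normB (zt j - u j t o) (zt i - u i t o).
by move: (k.+1%:R^-1) k0 h1 h2 => a k0 h1 h2; lra.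
Qed.

End LimitEvents.

(** * Convergence with positive probability *)

Section Rule.
Context {R : realType} {m : nat}.
Variable p : 'I_m.+1 -> R.
Hypothesis hp : type_rule p.

Lemma linearly_stable01 z : linearly_stable (rule_poly p) z ->
  [/\ 0 <= z <= 1, (rule_poly p).[z] = z & (rule_poly p)^`().[z] < 1].
Proof.
case=> -[zfix where_z] dz; split=> //.
by case: where_z => [[/andP[? ?] _]|[-> _]|[-> _]]; rewrite ?lexx ?ler01 // !ltW.
Qed.

(** If no vertex could ever become red, the polynomial of the rule would be 0 and
have no positive fixed point; if none could become blue, it would be 1. *)
Lemma both_colours_possible (z z' : R) : 0 <= z -> z < z' -> z' <= 1 ->
  (rule_poly p).[z] = z -> (rule_poly p).[z'] = z' ->
  forall a, exists2 k, (k <= m)%N & 0 < rule_chance p k a.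
Proof.
move=> z0 zz z1 zfix zfix' a; apply: contrapT => none.
have chance0 (k : 'I_m.+1) : rule_chance p k a = 0.
  apply/eqP; rewrite eq_le rule_chance_ge0 // andbT leNgt; apply/negP => pos.
  by apply: none; exists k => //; rewrite -ltnS.
case: a none chance0 => _; rewrite /rule_chance => chance0.
  move: zfix'; rewrite rule_polyE big1 => [|k _]; first by lra.
  by have := chance0 k; rewrite inord_val => ->; rewrite mulr0.
move: zfix; rewrite rule_polyE.
have -> : \sum_(k < m.+1) 'C(m, k)%:R * (z ^+ k * (1 - z) ^+ (m - k)) * p k =
    ((1 - z) + z) ^+ m.
  rewrite exprDn; apply: eq_bigr => k _.
  have := chance0 k; rewrite inord_val => /eqP; rewrite subr_eq0 => /eqP <-.
  by rewrite mulr1 mulr_natl mulrC.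
by rewrite subrK expr1n; lra.
Qed.

(** Linear stability at each of finitely many points yields one radius around all
of them on which the derivative is at most 1 - rho. *)
Lemma uniform_stability (I : finType) (f z : I -> R) :
  (forall i, 0 < f i) -> (forall i, linearly_stable (rule_poly p) (z i)) ->
  exists rho lam : R, [/\ 0 < rho, 0 <= lam, forall i, rho <= f i &
    forall i (y : R), `|y - z i| <= rho ->
      - lam <= (rule_poly p)^`().[y] <= 1 - rho].
Proof.
move=> f0 stab; set D := (rule_poly p)^`().
have gap i : 0 < (1 - D.[z i]) / 2.
  by have [_ _ dz] := linearly_stable01 (stab i); rewrite divr_gt0 // subr_gt0.
have rad i : exists r : R, 0 < r /\
    forall y, `|y - z i| <= r -> `|D.[y] - D.[z i]| <= (1 - D.[z i]) / 2.
  by have [r r0 hr] := horner_near D (z i) (gap i); exists r.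
have [r hr] := choice rad.
have [c1 c1_gt0 c1_le] := uniform_pos f0.
have [c2 c2_gt0 c2_le] := uniform_pos gap.
have [c3 c3_gt0 c3_le] := uniform_pos (fun i => (hr i).1).
pose rho := Num.min c1 (Num.min c2 c3).
have rho1 : rho <= c1 by rewrite /rho ge_min lexx.
have rho2 : rho <= c2 by rewrite /rho !ge_min lexx orbT.
have rho3 : rho <= c3 by rewrite /rho !ge_min lexx !orbT.
exists rho, (\sum_i (`|D.[z i]| + (1 - D.[z i]) / 2)).
have term0 i : 0 <= `|D.[z i]| + (1 - D.[z i]) / 2 by rewrite addr_ge0 // ltW.
split; first by rewrite !lt_min c1_gt0 c2_gt0.
- exact: sumr_ge0.
- by move=> i; apply: le_trans rho1 (c1_le i).
move=> i y yz; have := (hr i).2 y (le_trans yz (le_trans rho3 (c3_le i))).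
have : `|D.[z i]| + (1 - D.[z i]) / 2 <= \sum_i (`|D.[z i]| + (1 - D.[z i]) / 2).
  by rewrite (bigD1 i) //= lerDl; apply: sumr_ge0.
have := c2_le i; have := ler_norm (- D.[z i]); rewrite normrN.
move: (\sum_i _) => s h1 h2 h3; rewrite ler_norml => /andP[h4 h5].
by apply/andP; split; lra.
Qed.

End Rule.

Section Core.
Context {R : realType} {N m : nat}.
Variables (mu : 'I_N -> R) (p : 'I_m.+1 -> R) (G0 : cgraph N) (A1 : 'M[R]_N).
Hypotheses (hm : (1 <= m)%N) (hmu : community_law mu) (hp : type_rule p).
Hypotheses (hG0 : initial_graph m G0) (hA1 : attractiveness A1).
Hypotheses (hdiag : forall i, 0 < A1 i i) (hacc : types_accessible A1 p G0).

Lemma communities_exist : (0 < N)%N.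
Proof.
case: N mu hmu => // mu' [_ /eqP]; by rewrite big_ord0 eq_sym oner_eq0.
Qed.

(** A colour that cannot appear spontaneously is, by accessibility, present in
the initial graph at a community that leads to [i]. *)
Lemma colours_reachable theta : 0 < theta ->
  (forall a, exists2 k, (k <= m)%N & 0 < rule_chance p k a) ->
  exists t G, attainable mu (interpolation A1 theta) p G0 t G /\
    forall a i, coloured a G i.
Proof.
move=> t0 chs; have prG0 := initial_proper hG0.
have pA := interpolation_positive hA1 hdiag t0.
apply: all_colours_attainable => // i a.
have sub x y : connect [rel x y | 0 < A1 x y] x y ->
    connect [rel x y | 0 < interpolation A1 theta x y] x y.
  apply: connect_sub => u v /= Auv; apply: connect1 => /=.
  exact: interpolation_gt0.
have [acc_red acc_blue] := hacc i.
have [pos|npos] := ltP 0 (rule_chance p (if a then 0 else m) a); [by left|right].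
have zero : rule_chance p (if a then 0 else m) a = 0.
  by apply/eqP; rewrite eq_le npos rule_chance_ge0.
have [v [vn cv lv]] : exists v, [/\ (v < nvertices G0)%N, red G0 v = a &
    connect [rel x y | 0 < A1 x y] (comm G0 v) i].
  case: (a) zero; rewrite /rule_chance => zero.
    have [|v [vn rv lv]] := acc_red; last by exists v.
    by rewrite -zero; congr p; apply: val_inj; rewrite /= inordK.
  have [|v [vn /negbTE rv lv]] := acc_blue; last by exists v.
  have -> : ord_max = inord m :> 'I_m.+1 by apply: val_inj; rewrite /= inordK.
  by move: zero => /eqP; rewrite subr_eq0 => /eqP.
exists (comm G0 v); split; last exact: sub.
by exists v; split=> //; exact: initial_deg hG0 _ vn.
Qed.

Lemma energy_cvg (rho : R) (Xs Zs : 'I_N -> R) (G : nat -> cgraph N) (b : nat -> R) i :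
  0 < rho -> (forall t, rho / 2 <= degree_share m (G t) i) ->
  (forall t, b t * energy m Xs Zs (G t) <= 1) ->
  (forall M : R, exists n, forall t, (n <= t)%N -> M <= b t) ->
  red_proportion R (G t) i @[t --> \oo] --> Zs i.
Proof.
move=> rho0 Xlo bE binf; apply/cvgrPdist_le => e e0.
pose h := rho / 2 * e; have h0 : 0 < h by rewrite !mulr_gt0.
have [n hn] := binf (h ^+ 2)^-1; exists n => // t nt /=; rewrite distrC.
have h2 : 0 < h ^+ 2 by rewrite exprn_gt0.
have bt := hn t nt; have b0 : 0 < b t by apply: lt_le_trans bt; rewrite invr_gt0.
have E0 := lyapunov_ge0 Xs Zs (degree_share m (G t)) (red_proportion R (G t)).
rewrite -/(energy m Xs Zs (G t)) in E0.
have Eh : energy m Xs Zs (G t) <= h ^+ 2.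
  have : (h ^+ 2)^-1 * energy m Xs Zs (G t) <= 1.
    by apply: le_trans (bE t); rewrite ler_wpM2r.
  by rewrite mulrC ler_pdivrMr // mul1r.
have [_ le_i] := lyapunov_coord Xs Zs (degree_share m (G t)) (red_proportion R (G t)) i.
have sqrt_h : Num.sqrt (energy m Xs Zs (G t)) <= h.
  by rewrite -(ger0_norm (ltW h0)) -sqrtr_sqr ler_wsqrtr.
have Xt := Xlo t.
have := le_trans (norm_le_sqrt le_i) sqrt_h.
rewrite normrM ger0_norm => [le_h|]; last lra.
have : rho / 2 * `|red_proportion R (G t) i - Zs i| <= rho / 2 * e.
  by apply: le_trans le_h; rewrite ler_wpM2r.
by rewrite ler_pM2l //; lra.
Qed.


(** The energy controls X - Xs at once, and Z - Zs after division by X. The level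
(rho^3 / 32)^2 is small enough for the region of [drift_negative]. *)
Lemma energy_region (rho eta : R) (z Xs Zs X Z : 'I_N -> R) :
  0 < rho -> rho <= 1 -> (forall i, rho <= mu i) ->
  eta <= rho ^+ 3 / 32 -> near_target mu z eta Xs Zs ->
  lyapunov Xs Zs X Z < (rho ^+ 3 / 32) ^+ 2 ->
  near_target mu z (rho ^+ 2 / 8) X Z /\ forall i, rho / 2 <= X i.
Proof.
move=> rho0 rho1 rho_mu eta_om near lt_om; set om := rho ^+ 3 / 32 in eta_om lt_om.
have omE : om = rho ^+ 3 / 32 by [].
have rho2_gt0 : 0 < rho ^+ 2 by rewrite exprn_gt0.
have rho21 : rho ^+ 2 <= rho by rewrite expr2 ler_piMr // ltW.
have rho32 : rho ^+ 3 <= rho ^+ 2 by rewrite exprSr ler_piMr // ltW.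
have om0 : 0 < om by rewrite divr_gt0 ?exprn_gt0.
have V0 := lyapunov_ge0 Xs Zs X Z.
have sqrt_om : Num.sqrt (lyapunov Xs Zs X Z) <= om.
  by rewrite -(ger0_norm (ltW om0)) -sqrtr_sqr ler_wsqrtr // ltW.
have dX i : `|X i - Xs i| <= om.
  by apply: le_trans sqrt_om; apply: norm_le_sqrt; case: (lyapunov_coord Xs Zs X Z i).
have Xlo i : rho / 2 <= X i.
  have [+ _] := near i; have := dX i; have := rho_mu i.
  by rewrite !ler_norml => ? /andP[? ?] /andP[? ?]; lra.
split=> // i; have [nX nZ] := near i; split.
  move: nX (dX i); rewrite !ler_norml => /andP[? ?] /andP[? ?].
  by apply/andP; split; lra.
have dU : `|X i * (Z i - Zs i)| <= om.
  by apply: le_trans sqrt_om; apply: norm_le_sqrt; case: (lyapunov_coord Xs Zs X Z i).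
have dZ : `|Z i - Zs i| <= rho ^+ 2 / 16.
  have Xi := Xlo i; move: dU; rewrite normrM ger0_norm; last lra.
  move=> dU; have : rho / 2 * `|Z i - Zs i| <= rho / 2 * (rho ^+ 2 / 16).
    apply: (@le_trans _ _ (X i * `|Z i - Zs i|)); first by rewrite ler_wpM2r.
    by apply: le_trans dU _; rewrite omE exprSr; lra.
  by rewrite ler_pM2l //; lra.
move: nZ dZ; rewrite !ler_norml => /andP[? ?] /andP[? ?].
by apply/andP; split; lra.
Qed.

Lemma energy_start (eta : R) (z Xs Zs : 'I_N -> R) (G : cgraph N) : proper m G ->
  near_target mu z eta Xs Zs ->
  near_target mu z eta (degree_share m G) (red_proportion R G) ->
  energy m Xs Zs G <= 8 * N%:R * eta ^+ 2.
Proof.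
move=> pr nS nG.
have -> : 8 * N%:R * eta ^+ 2 = \sum_(i < N) (8 * eta ^+ 2 : R).
  by rewrite sumr_const card_ord -mulr_natr; ring.
apply: ler_sum => i _; have [sX sZ] := nS i; have [gX gZ] := nG i.
have dX : `|degree_share m G i - Xs i| <= 2 * eta.
  by move: sX gX; rewrite !ler_norml => /andP[? ?] /andP[? ?]; apply/andP; split; lra.
have dZ : `|red_proportion R G i - Zs i| <= 2 * eta.
  by move: sZ gZ; rewrite !ler_norml => /andP[? ?] /andP[? ?]; apply/andP; split; lra.
have /andP[X0 X1] := degree_share01 (R := R) hm i pr.
have dU : `|degree_share m G i * (red_proportion R G i - Zs i)| <= 1 * (2 * eta).
  by apply: norm_mul_le => //; rewrite ger0_norm // ltW.
by have := sqr_le_of_norm dX; have := sqr_le_of_norm dU; lra.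
Qed.

Lemma nvertices_pa_graph c (w : nat -> m.-tuple nat) b t :
  nvertices (pa_graph G0 c w b t) = (nvertices G0 + t)%N.
Proof. by elim: t => [|t /= ->]; rewrite ?addn0 ?addnS. Qed.

(** The bad graphs are those with g V at least the level om^2. Where the graph is
not bad, V is below this level since g is at least 1, so that the drift estimate
holds and the potential g (V + 4 K / (n - 1)) / om^2 decreases in the mean. Never
being bad means that V is at most om^2 / g, which tends to 0. *)
Lemma stays_and_converges (theta rho eta : R) (z Xs Zs : 'I_N -> R) :
  let A := interpolation A1 theta in
  0 < theta -> 0 < rho -> rho <= 1 -> (forall i, rho <= mu i) ->
  (forall i, 0 <= z i <= 1) -> (forall i, (rule_poly p).[z i] = z i) ->
  (forall a, exists2 k, (k <= m)%N & 0 < rule_chance p k a) ->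
  0 < eta -> 8 * N%:R * eta <= rho ^+ 3 / 32 ->
  near_target mu z eta Xs Zs ->
  (forall X Z, near_target mu z (rho ^+ 2 / 8) X Z ->
     drift mu A p Xs Zs X Z <= - (rho ^+ 2 / 16) * lyapunov Xs Zs X Z) ->
  forall (d : measure_display) (T : measurableType d) (P : probability T R)
    (C : nat -> T -> 'I_N) (W : nat -> T -> m.-tuple nat) (B : nat -> T -> bool),
  pa_model C W B P mu A p G0 ->
  exists E : set T, [/\ measurable E, (0 < P E)%E &
    forall o, E o -> forall i,
      red_proportion R (random_graph C W B G0 t o) i @[t --> \oo] --> Zs i].
Proof.
move=> A theta0 rho0 rho1 rho_mu z01 zfix chs eta0 eta_om near_eq drift_neg.
move=> d T P C W B model.
have N0 := communities_exist; have pA := interpolation_positive hA1 hdiag theta0.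
have prG0 := initial_proper hG0.
have N1 : 1 <= N%:R :> R by rewrite ler1n.
set om := rho ^+ 3 / 32 in eta_om.
have om0 : 0 < om by rewrite divr_gt0 ?exprn_gt0.
have om1 : om <= 1 / 32.
  have := exprn_ile1 3 (ltW rho0) rho1; rewrite /om; lra.
have eta_le : eta <= om.
  have : eta <= N%:R * eta by rewrite ler_peMl // ltW.
  lra.
have om2 : 0 < om ^+ 2 by rewrite exprn_gt0.
pose c0 := rho ^+ 2 / 16; have c00 : 0 < c0 by rewrite divr_gt0 ?exprn_gt0.
pose gam := Num.min c0 (1 / 2).
have gam0 : 0 < gam by rewrite lt_min c00 /=; lra.
have gam_c : gam <= c0 by rewrite ge_min lexx.
have gam_2 : gam <= 1 / 2 by rewrite ge_min lexx orbT.
pose K : R := 37 * N%:R; have K0 : 0 <= K by rewrite mulr_ge0.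
(* Late enough for 4 K / (n - 1) to be at most om^2 / 4. *)
pose n0 := (2 + Num.bound (16 * K / om ^+ 2))%N.
have [ts [G [aG n0G nearG]]] := target_attainable hmu hp pA hm prG0 N0 z01 zfix
   (colours_reachable theta0 chs) eta0 n0.
have prG := attainable_proper prG0 aG.
set ns := nvertices G in n0G.
have ns1 : (1 < ns)%N by apply: leq_trans n0G; rewrite /n0 leq_addr.
have nsb : (Num.bound (16 * K / om ^+ 2) < ns)%N.
  by apply: leq_trans n0G; rewrite /n0 add2n ltnS leqnSn.
pose g n := multiplier gam ns n.
pose V G' := energy m Xs Zs G'.
pose bad G' := om ^+ 2 <= g (nvertices G') * V G' : Prop.
pose pot G' := (om ^+ 2)^-1 * (g (nvertices G') * (V G' + 4 * K / (nvertices G').-1%:R)).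
pose inv (G' : cgraph N) := proper m G' /\ (ns <= nvertices G')%N.
have V0 G' : 0 <= V G' by apply: lyapunov_ge0.
have g1 n : (ns <= n)%N -> 1 <= g n by apply: multiplier_ge1 (ltW _).
have g0 n : (ns <= n)%N -> 0 <= g n by move=> nsn; apply: le_trans ler01 (g1 n nsn).
have Zs2 i : `|Zs i| <= 2.
  have [_ nZ] := near_eq i; have /andP[? ?] := z01 i.
  by move: nZ; rewrite !ler_norml => /andP[? ?]; apply/andP; split; lra.
have region G' : (ns <= nvertices G')%N -> ~ bad G' ->
    near_target mu z (rho ^+ 2 / 8) (degree_share m G') (red_proportion R G') /\
    forall i, rho / 2 <= degree_share m G' i.
  move=> nsG /negP; rewrite -ltNge => not_bad.
  apply: energy_region eta_le near_eq _ => //; apply: le_lt_trans not_bad.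
  by rewrite -/(energy m Xs Zs G') -/(V G') ler_peMl ?g1.
have pot_ge0 G' : inv G' -> 0 <= pot G'.
  move=> [_ nsG]; rewrite mulr_ge0 ?invr_ge0 ?(ltW om2) //.
  by rewrite mulr_ge0 ?(g0 _ nsG) // addr_ge0 // divr_ge0 // mulr_ge0.
have pot_bad G' : inv G' -> bad G' -> 1 <= pot G'.
  move=> [_ nsG] badG; rewrite /pot -ler_pdivrMl ?invr_gt0 // invrK mulr1.
  apply: le_trans badG _; rewrite ler_wpM2l ?(g0 _ nsG) // lerDl.
  by rewrite divr_ge0 ?mulr_ge0.
have pot_super G' : inv G' -> ~ bad G' -> step_mean mu A p G' pot <= pot G'.
  move=> [prG' nsG] not_bad; have [nearG' _] := region G' nsG not_bad.
  set n := nvertices G' in nsG.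
  have -> : step_mean mu A p G' pot = (om ^+ 2)^-1 *
      (g n.+1 * (step_mean mu A p G' V + 4 * K / n%:R)).
    rewrite (step_mean_eq hmu hp pA (H := fun H => (om ^+ 2)^-1 *
      (g n.+1 * (V H + 4 * K / n%:R)))) //.
    by rewrite !step_meanZ step_meanD step_mean_const.
  rewrite ler_wpM2l ?invr_ge0 ?(ltW om2) //.
  apply: (@multiplier_supermartingale _ gam c0 K) => //.
    exact: leq_trans ns1 nsG.
  apply: le_trans (energy_step hmu hp pA hm Xs prG' Zs2) _.
  by rewrite -/n lerD2r lerD2l ler_wpM2l ?divr_ge0 //; apply: drift_neg.
have [c [w [b [GE Ppos]]]] := attainable_realized model aG.
have start_lt1 : pot G < 1.
  rewrite /pot -/ns /g multiplier_start mul1r mulrC ltr_pdivrMr // mul1r.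
  have VG : V G <= 8 * N%:R * eta ^+ 2 by apply: energy_start near_eq nearG.
  have : 8 * N%:R * eta ^+ 2 <= om * eta.
    by rewrite expr2 mulrA ler_wpM2r // ltW.
  have : 4 * K / ns.-1%:R <= om ^+ 2 / 4.
    have nsK : 16 * K / om ^+ 2 <= ns.-1%:R.
      have Kb : 0 <= 16 * K / om ^+ 2 by rewrite divr_ge0 ?mulr_ge0 // ltW.
      apply: le_trans (ltW (archi_boundP Kb)) _.
      by rewrite ler_nat -ltnS (ltn_predK nsb).
    rewrite ler_pdivrMr ?ltr0n; last by rewrite -ltnS (ltn_predK ns1).
    move: nsK; rewrite ler_pdivrMr // [_ * om ^+ 2]mulrC; lra.
  have : om * eta <= om ^+ 2 / 8.
    have : 8 * eta <= 8 * (N%:R * eta).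
      by rewrite ler_wpM2l // ler_peMl // ltW.
    move=> h; have : om * (8 * eta) <= om * om by rewrite ler_wpM2l ?(ltW om0) //; lra.
    by rewrite expr2; lra.
  lra.
pose E := history C W B ts c w b `&`
  [set o | forall s, (ts <= s)%N -> ~ bad (random_graph C W B G0 s o)].
have mE : measurable E.
  apply: measurableI; first exact: measurable_history model _ _ _ _.
  rewrite (_ : [set o | _] = \bigcap_(s in [set s | (ts <= s)%N])
      [set o | ~ bad (random_graph C W B G0 s o)]).
    apply: bigcap_measurable => [|s _]; first by exists ts => /=.
    exact: (measurable_graph model s (fun G' => ~ bad G')).
  by apply/seteqP; split.
exists E; split=> //.
  apply: (never_bad_positive model (I := inv) (L := pot)); rewrite ?GE //.
  - by move=> G' [[]].
  - move=> G' x w' b' [pr' nsG] w_lt; split; first exact: add_vertex_proper.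
    exact: leqW.
move=> o [ho never] i; rewrite -(cvg_shiftn ts).
pose Gs k := random_graph C W B G0 (k + ts) o.
have nGs k : nvertices (Gs k) = (ns + k)%N.
  by rewrite /ns -GE /Gs /random_graph !nvertices_pa_graph addnA addnAC.
have goodG k : ~ bad (Gs k) by apply: never; rewrite leq_addl.
have nsk k : (ns <= nvertices (Gs k))%N by rewrite nGs leq_addr.
apply: (@energy_cvg rho Xs Zs Gs (fun k => (om ^+ 2)^-1 * g (nvertices (Gs k)))) => //.
- by move=> k; have [_] := region (Gs k) (nsk k) (goodG k).
- move=> k; rewrite -mulrA mulrC ler_pdivrMr // mul1r ltW // ltNge.
  exact/negP/goodG.
move=> M; have [n1 hn1] := multiplier_unbounded ns (M * om ^+ 2) gam0.
exists n1 => k n1k; rewrite mulrC ler_pdivlMr //; apply: hn1.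
by rewrite nGs; apply: leq_trans n1k (leq_addl _ _).
Qed.

(** Choice of the constants, in this order: rho from the stability of the z_i and
from mu, the distance eta of the equilibrium and of the start from the target,
and the bound tau on the strength theta * L of the coupling. *)
Lemma convergence_near (z : 'I_N -> R) (eps : R) :
  (forall i, linearly_stable (rule_poly p) (z i)) -> 0 < eps ->
  (forall a, exists2 k, (k <= m)%N & 0 < rule_chance p k a) ->
  exists2 theta_eps : R, 0 < theta_eps & forall theta : R, 0 < theta < theta_eps ->
  forall (d : measure_display) (T : measurableType d) (P : probability T R)
    (C : nat -> T -> 'I_N) (W : nat -> T -> m.-tuple nat) (B : nat -> T -> bool),
  pa_model C W B P mu (interpolation A1 theta) p G0 ->
  exists (Zs : 'I_N -> R) (E : set T), [/\ measurable E, (0 < P E)%E,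
    forall i, `|z i - Zs i| < eps &
    forall o, E o -> forall i,
      red_proportion R (random_graph C W B G0 t o) i @[t --> \oo] --> Zs i].
Proof.
move=> stab eps0 chs; have N0 := communities_exist.
have mu0 i : 0 < mu i by case: hmu.
have mu1 := community_law_le1 hmu.
have i0 : 'I_N by case: (N) N0 => // n _; exact: ord0.
have [rho [lam [rho0 lam0 rho_mu dQ]]] := uniform_stability mu0 stab.
have z01 i : 0 <= z i <= 1 by have [] := linearly_stable01 (stab i).
have zfix i : (rule_poly p).[z i] = z i by have [] := linearly_stable01 (stab i).
have rho1 : rho <= 1 := le_trans (rho_mu i0) (mu1 i0).
have half0 : 0 < rho / 2 by rewrite divr_gt0.
have [L L0 weak] := weak_coupling hA1 hdiag hmu half0.
have N1 : 1 <= N%:R :> R by rewrite ler1n.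
have rho3 : rho ^+ 3 <= rho ^+ 2 by rewrite exprSr ler_piMr // ?exprn_ge0 // ltW.
have rho2 : rho ^+ 2 <= rho by rewrite expr2 ler_piMr // ltW.
have rho3_gt0 : 0 < rho ^+ 3 by rewrite exprn_gt0.
pose eta := Num.min (eps / 2) (rho ^+ 3 / 32 / (8 * N%:R)).
have N8 : 0 < 8 * N%:R :> R by lra.
have eta0 : 0 < eta by rewrite lt_min !divr_gt0.
have eta_eps : eta <= eps / 2 by rewrite ge_min lexx.
have eta_om : 8 * N%:R * eta <= rho ^+ 3 / 32.
  by rewrite mulrC -ler_pdivlMr // ge_min lexx orbT.
have eta_small : eta <= rho ^+ 3 / 256.
  have : 8 * eta <= 8 * (N%:R * eta) by rewrite ler_wpM2l // ler_peMl // ltW.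
  by rewrite mulrA; lra.
have [eta_half eta_quarter eta_one] : [/\ eta <= rho / 2, eta <= rho / 4 & eta <= 1].
  by split; lra.
pose kk := N%:R * (2 + lam) * (rho / 2) ^- 2.
have kk0 : 0 < kk by rewrite !mulr_gt0 ?invr_gt0 ?exprn_gt0 //; lra.
pose tau := Num.min (Num.min (eta / 2) (rho * eta / (2 * (1 + lam))))
                    (Num.min (rho ^+ 2 / 8) (rho ^+ 2 / 16 / kk)).
have lam1 : 0 < 1 + lam by lra.
have rho2_gt0 : 0 < rho ^+ 2 by rewrite exprn_gt0.
have tau0 : 0 < tau.
  by rewrite !lt_min (divr_gt0 eta0) // (divr_gt0 rho2_gt0) // (divr_gt0 _ kk0) ?andbT
    ?divr_gt0 ?mulr_gt0.
exists (Num.min 1 (tau / L)); first by rewrite lt_min ltr01 divr_gt0.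
move=> theta /andP[theta0]; rewrite lt_min => /andP[theta1].
rewrite ltr_pdivlMr // => /ltW; set t := theta * L; rewrite !le_min.
move=> /andP[/andP[t1 t2] /andP[t3 t4]].
have t0 : 0 <= t by rewrite mulr_ge0 // ltW.
have th : 0 < theta < 1 by rewrite theta0.
move=> d T P C W B model; set A := interpolation A1 theta in model.
have weakA := weak theta th.
have [Xs [Zs [near_eq Xfix Zfix]]] : exists Xs Zs : 'I_N -> R,
    [/\ near_target mu z eta Xs Zs, forall i, inflow A mu Xs i = Xs i &
        forall i, (rule_poly p).[mixture A Xs Zs i] = Zs i].
  apply: (equilibrium_exists rho0 lam0 rho_mu mu1 z01 zfix dQ t0 weakA) => //.
  by rewrite mulrCA -ler_pdivlMr ?mulr_gt0.
have near4 : near_target mu z (rho / 4) Xs Zs.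
  by move=> i; have [nX nZ] := near_eq i; split;
    [apply: le_trans nX _ | apply: le_trans nZ _].
have kkt : kk * t <= rho ^+ 2 / 16 by move: t4; rewrite ler_pdivlMr // mulrC.
have drift_neg X Z : near_target mu z (rho ^+ 2 / 8) X Z ->
    drift mu A p Xs Zs X Z <= - (rho ^+ 2 / 16) * lyapunov Xs Zs X Z.
  by move=> nXZ; apply: (drift_negative rho0 lam0 rho_mu mu1 z01 dQ t0 weakA).
have [E [mE PE cv]] := stays_and_converges theta0 rho0 rho1 rho_mu z01 zfix chs eta0
  eta_om near_eq drift_neg model.
exists Zs, E; split=> // i; rewrite distrC.
by have [_] := near_eq i; lra.
Qed.

End Core.

Theorem theorem3p1 (R : realType) (N m : nat) (hm : (1 <= m)%N)
    (mu : 'I_N -> R) (hmu : community_law mu)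
    (p : 'I_m.+1 -> R) (hp : type_rule p)
    (G0 : cgraph N) (hG0 : initial_graph m G0)
    (A1 : 'M[R]_N) (hA1 : attractiveness A1) (hdiag : forall i, 0 < A1 i i)
    (hacc : types_accessible A1 p G0)
    (htwo : exists z z' : R, [/\ z != z', linearly_stable (rule_poly p) z &
                                 linearly_stable (rule_poly p) z']) :
  (forall z : 'I_N -> R, (forall i, linearly_stable (rule_poly p) (z i)) ->
   forall eps : R, 0 < eps ->
   exists2 theta_eps : R, 0 < theta_eps &
   forall theta : R, 0 < theta < theta_eps ->
   forall (d : measure_display) (T : measurableType d) (P : probability T R)
     (C : nat -> T -> 'I_N) (W : nat -> T -> m.-tuple nat) (B : nat -> T -> bool),
   pa_model C W B P mu (interpolation A1 theta) p G0 ->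
   positive_probability P
     [set o | exists zt : 'I_N -> R, forall i,
        `|z i - zt i| < eps /\
        red_proportion R (random_graph C W B G0 t o) i @[t --> \oo] --> zt i])
  /\
  ((2 <= N)%N ->
   exists2 theta_crit : R, 0 < theta_crit &
   forall theta : R, 0 < theta < theta_crit ->
   forall (d : measure_display) (T : measurableType d) (P : probability T R)
     (C : nat -> T -> 'I_N) (W : nat -> T -> m.-tuple nat) (B : nat -> T -> bool),
   pa_model C W B P mu (interpolation A1 theta) p G0 ->
   positive_probability P
     [set o | exists zt : 'I_N -> R,
        (forall i,
           red_proportion R (random_graph C W B G0 t o) i @[t --> \oo] --> zt i) /\
        (exists i j, zt i != zt j)]).
Proof.
have [z [z' [zz stz stz']]] := htwo.
have chs : forall a, exists2 k, (k <= m)%N & 0 < rule_chance p k a.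
  have [/andP[z0 z1] zfix _] := linearly_stable01 stz.
  have [/andP[z'0 z'1] zfix' _] := linearly_stable01 stz'.
  move: zz; rewrite neq_lt => /orP[lt_zz|lt_zz].
    exact: (both_colours_possible hp z0 lt_zz z'1 zfix zfix').
  exact: (both_colours_possible hp z'0 lt_zz z1 zfix' zfix).
have core := fun w eps stw eps0 =>
  convergence_near hm hmu hp hG0 hA1 hdiag hacc (z := w) (eps := eps) stw eps0 chs.
split=> [w stw eps eps0|N2].
  have [theta_eps theta_eps0 converges] := core w eps stw eps0.
  exists theta_eps => // theta theta_lt d T P C W B model.
  have [Zs [E [mE PE near cv]]] := converges theta theta_lt d T P C W B model.
  have mL := measurable_limits_near model w eps.
  split=> //; apply: lt_le_trans PE _; apply: le_measure; rewrite ?inE //.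
  by move=> o Eo; exists Zs => i; split; [exact: near | exact: cv].
(* One community is aimed at z, all others at z', with error less than half
   the distance. *)
pose i0 := Ordinal (ltnW N2); pose i1 := Ordinal N2.
pose w (i : 'I_N) := if i == i0 then z else z'.
have stw i : linearly_stable (rule_poly p) (w i) by rewrite /w; case: ifP.
have eps0 : 0 < `|z - z'| / 2 by rewrite divr_gt0 // normr_gt0 subr_eq0.
have [theta_crit theta_crit0 converges] := core w _ stw eps0.
exists theta_crit => // theta theta_lt d T P C W B model.
have [Zs [E [mE PE near cv]]] := converges theta theta_lt d T P C W B model.
have mL := measurable_limits_differ model.
split=> //; apply: lt_le_trans PE _; apply: le_measure; rewrite ?inE //.
move=> o Eo; exists Zs; split; first exact: cv.
exists i0, i1; apply/eqP => Zs01.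
have := near i0; have := near i1; rewrite /w eqxx /= -Zs01 => near1 near0.
have : `|z - z'| <= `|z - Zs i0| + `|z' - Zs i0|.
  rewrite (_ : z - z' = (z - Zs i0) - (z' - Zs i0)); last by ring.
  exact: ler_normB.
lra.
Qed.
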